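(* Let $R$ be a commutative noetherian ring with nonzero identity. If $M$ is an $R$-module with $\operatorname{Gfd}_R M<\infty$, then $M$ has a monic $\mathrm{CF}(R)$-preenvelope $\varphi\colon M\to K$ such that $\operatorname{fd}_R K=\operatorname{Gfd}_R M$ and $\operatorname{coker}\varphi$ is Gorenstein flat.
   Context: An exact complex $F$ of flat $R$-modules (indexed by $\mathbb Z$) is a complete flat resolution if $J\otimes_R F$ is exact for each injective $R$-module $J$. An $R$-module is Gorenstein flat if it is a cokernel of (a differential of) a complete flat resolution. A Gorenstein flat resolution of $M$ is a complex $G=\cdots\to G_1\to G_0\to 0$ of Gorenstein flat modules with an augmentation $G_0\to M$ such that $\cdots\to G_1\to G_0\to M\to 0$ is exact; $\operatorname{Gfd}_R M$ is the infimum, over all Gorenstein flat resolutions $G$ of $M$, of $\sup\{i\geq 0\mid G_i\neq 0\}$. $\operatorname{fd}_R$ denotes flat dimension. An $R$-module $K$ is cotorsion if $\operatorname{Ext}^i_R(F,K)=0$ for each $i>0$ and each flat $R$-module $F$. $\mathrm{CF}(R)$ is the class of cotorsion $R$-modules of finite flat dimension. A homomorphism $\varphi\colon M\to K$ with $K\in\mathrm{CF}(R)$ is a $\mathrm{CF}(R)$-preenvelope if for each $Y\in\mathrm{CF}(R)$ the map $\operatorname{Hom}_R(\varphi,Y)\colon\operatorname{Hom}_R(K,Y)\to\operatorname{Hom}_R(M,Y)$ is surjective. *)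

(* Defs.v *)
From HB Require Import structures.
From mathcomp Require Import all_boot all_order all_algebra.
From mathcomp Require Import boolp classical_sets constructive_ereal.
From mathcomp Require Import freeg.

Set Implicit Arguments.
Unset Strict Implicit.
Unset Printing Implicit Defensive.

Import GRing.Theory.
Local Open Scope quotient_scope.
Local Open Scope ring_scope.

(* [submodClosed] of ssralg lives over semirings and carries no [zmodClosed]
   structure, hence this bundling of [submod_closed]. *)
Record submodule (R : nzRingType) (V : lmodType R) := Submodule {
  submod_pred :> {pred V};
  submod_closedP : submod_closed submod_pred }.

HB.instance Definition _ (R : nzRingType) (V : lmodType R)
    (I : submodule V) :=
  GRing.isZmodClosed.Build V (submod_pred I)
    (GRing.submod_closedB (submod_closedP I)).

Section QuotientModule.
Variables (R : nzRingType) (V : lmodType R) (I : submodule V).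

Definition quotmod := Quotient.quot (submod_pred I).
HB.instance Definition _ := GRing.Zmodule.on quotmod.
HB.instance Definition _ := Quotient.on quotmod.

Local Notation pi := (\pi_quotmod).

Definition quotmod_scale (a : R) (x : quotmod) : quotmod := pi (a *: repr x).

Lemma quotmod_piP (x y : V) :
  reflect (pi x = pi y) (x - y \in submod_pred I).
Proof. by rewrite Quotient.idealrBE; apply: eqP. Qed.

Lemma quotmod_piZ a x : quotmod_scale a (pi x) = pi (a *: x).
Proof.
apply/quotmod_piP; rewrite -scalerBr -[_ *: _]addr0.
have [I0 IZ] := submod_closedP I; apply: IZ => //.
by apply/quotmod_piP; rewrite reprK.
Qed.

Lemma quotmod_piD x y : pi x + pi y = pi (x + y).
Proof. exact/esym/Quotient.pi_add. Qed.

Fact quotmod_scaleA a b x :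
  quotmod_scale a (quotmod_scale b x) = quotmod_scale (a * b) x.
Proof. by elim/quotW: x => x; rewrite (quotmod_piZ b) !quotmod_piZ scalerA. Qed.

Fact quotmod_scale1 : left_id 1 quotmod_scale.
Proof. by elim/quotW=> x; rewrite quotmod_piZ scale1r. Qed.

Fact quotmod_scaleDr : right_distributive quotmod_scale +%R.
Proof.
move=> a; elim/quotW=> x; elim/quotW=> y.
by rewrite quotmod_piD !quotmod_piZ quotmod_piD scalerDr.
Qed.

Fact quotmod_scaleDl x : {morph quotmod_scale^~ x : a b / a + b}.
Proof.
by move=> a b; elim/quotW: x => x; rewrite !quotmod_piZ quotmod_piD scalerDl.
Qed.

HB.instance Definition _ := GRing.Zmodule_isLmodule.Build R quotmod
  quotmod_scaleA quotmod_scale1 quotmod_scaleDr quotmod_scaleDl.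

Definition quot_proj (x : V) : quotmod := pi x.

Fact quot_proj_linear : linear quot_proj.
Proof. by move=> a x y; rewrite /quot_proj -quotmod_piD -quotmod_piZ. Qed.
HB.instance Definition _ :=
  GRing.isLinear.Build R V quotmod _ quot_proj quot_proj_linear.

Lemma quot_proj_surj y : exists x, quot_proj x = y.
Proof. by exists (repr y); rewrite /quot_proj reprK. Qed.

Lemma quot_proj_eq0 x : quot_proj x = 0 <-> x \in submod_pred I.
Proof.
rewrite -{2}[x]subr0 -(raddf0 quot_proj).
by split=> [/quotmod_piP|/quotmod_piP].
Qed.

End QuotientModule.

Section Coker.
Variables (R : nzRingType) (A B : lmodType R) (f : {linear A -> B}).

Fact im_submod_closed : submod_closed [pred y : B | `[< exists x, f x = y >]].
Proof.
split=> [|a _ _ /asboolP[x <-] /asboolP[y <-]].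
  by apply/asboolP; exists 0; rewrite linear0.
by apply/asboolP; exists (a *: x + y); rewrite linearP.
Qed.

Definition im : submodule B := Submodule im_submod_closed.

Definition coker : lmodType R := quotmod im.

End Coker.

Section FreeModule.
Variables (R : nzRingType) (X : choiceType).

Definition free_mod : lmodType R := {freeg X / R}.

Definition free_gen (x : X) : free_mod := Freeg [:: (1, x)].

Section Lift.
Variables (V : lmodType R) (f : X -> V).

Let free_lift_fun : free_mod -> V := fglift f.

Fact free_lift_linear : linear free_lift_fun.
Proof.
pose L : {additive _ -> _} := HB.pack (fglift f : {freeg X / R} -> V)
  (GRing.isZmodMorphism.Build _ _ _ (lift_is_additive f)).
move=> a u v; rewrite -[free_lift_fun]/(L : _ -> _) raddfD; congr (_ + _).
rewrite -{2}[u]freeg_sumE [a *: u]/(fgscale a u) !raddf_sum.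
by apply: eq_bigr => x _; rewrite [LHS](liftU f) [L _](liftU f) -scalerA.
Qed.
HB.instance Definition _ :=
  GRing.isLinear.Build R free_mod V _ free_lift_fun free_lift_linear.

Definition free_lift : {linear free_mod -> V} := free_lift_fun.

Lemma free_liftE x : free_lift (free_gen x) = f x.
Proof. by rewrite [LHS](liftU f) scale1r. Qed.

End Lift.

Lemma free_lin_ext (V : lmodType R) (f g : {linear free_mod -> V}) :
  (forall x, f (free_gen x) = g (free_gen x)) -> f =1 g.
Proof.
move=> fg u; rewrite -[u]freeg_sumE !linear_sum; apply: eq_bigr => x _.
have -> : Freeg [:: (coeff x u, x)] = coeff x u *: free_gen x.
  by apply/eqP/freeg_eqP => z; rewrite coeffZ !coeffU mul1r.
by rewrite !linearZ_LR fg.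
Qed.

End FreeModule.

(* Tensor product over a commutative ring: the free module on [A * B] modulo
   the submodule generated by the bilinearity relations. *)
Section Tensor.
Variable R : comNzRingType.

Section TensorProduct.
Variables A B : lmodType R.

Let gen (a : A) (b : B) : free_mod R (A * B)%type := free_gen R (a, b).

Inductive tensor_rel : free_mod R (A * B)%type -> Prop :=
| tensor_rel0 : tensor_rel 0
| tensor_relP r u v : tensor_rel u -> tensor_rel v -> tensor_rel (r *: u + v)
| tensor_relDl a a' b : tensor_rel (gen (a + a') b - (gen a b + gen a' b))
| tensor_relDr a b b' : tensor_rel (gen a (b + b') - (gen a b + gen a b'))
| tensor_relZl r a b : tensor_rel (gen (r *: a) b - r *: gen a b)
| tensor_relZr r a b : tensor_rel (gen a (r *: b) - r *: gen a b).

Fact tensor_rel_closed : submod_closed [pred u | `[< tensor_rel u >]].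
Proof.
split=> [|r u v /asboolP Hu /asboolP Hv]; apply/asboolP.
  exact: tensor_rel0.
exact: tensor_relP.
Qed.

Definition tensor : lmodType R := quotmod (Submodule tensor_rel_closed).

Definition tens (a : A) (b : B) : tensor := quot_proj _ (gen a b).

Fact tens_bilinear : bilinear_for *:%R *:%R tens.
Proof.
have E u v : tensor_rel (u - v) ->
    quot_proj (Submodule tensor_rel_closed) u = quot_proj _ v.
  by move=> uv; apply/quotmod_piP/asboolP.
split=> [b r a a'|a r b b'] /=; rewrite /tens -linearP.
  rewrite (E _ _ (tensor_relDl _ _ _)) !linearD; congr (_ + _).
  exact/E/tensor_relZl.
rewrite (E _ _ (tensor_relDr _ _ _)) !linearD; congr (_ + _).
exact/E/tensor_relZr.
Qed.
HB.instance Definition _ :=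
  bilinear_isBilinear.Build R A B tensor _ _ tens tens_bilinear.

Section Lift.
Variables (C : lmodType R) (beta : {bilinear A -> B -> C}).

Let betaF : {linear free_mod R (A * B)%type -> C} :=
  free_lift (fun p => beta p.1 p.2).

Definition tensor_lift_fun (t : tensor) : C := betaF (repr t).

Let betaF_rel u : tensor_rel u -> betaF u = 0.
Proof.
have Lgen a b : betaF (gen a b) = beta a b by rewrite /betaF free_liftE.
elim=> [|r {}u v _ u0 _ v0|a a' b|a b b'|r a b|r a b].
- by rewrite linear0.
- by rewrite linearP u0 v0 scaler0 addr0.
- by rewrite linearB linearD !Lgen linearDl subrr.
- by rewrite linearB linearD !Lgen linearDr subrr.
- by rewrite linearB linearZ !Lgen linearZl_LR subrr.
- by rewrite linearB linearZ !Lgen linearZr_LR subrr.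
Qed.

Let tensor_lift_proj u : tensor_lift_fun (quot_proj _ u) = betaF u.
Proof.
rewrite /tensor_lift_fun; set v := repr _.
have : tensor_rel (v - u).
  by apply/asboolP/(quotmod_piP (Submodule tensor_rel_closed)); rewrite reprK.
by move/betaF_rel/eqP; rewrite linearB subr_eq0 => /eqP.
Qed.

Fact tensor_lift_linear : linear tensor_lift_fun.
Proof.
move=> r t u.
have [x <-] := quot_proj_surj t; have [y <-] := quot_proj_surj u.
by rewrite -linearP !tensor_lift_proj linearP.
Qed.
HB.instance Definition _ :=
  GRing.isLinear.Build R tensor C _ tensor_lift_fun tensor_lift_linear.

Definition tensor_lift : {linear tensor -> C} := tensor_lift_fun.

Lemma tensor_liftE a b : tensor_lift (tens a b) = beta a b.
Proof. by rewrite [LHS]tensor_lift_proj /betaF free_liftE. Qed.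

End Lift.

Lemma tensor_lin_ext (C : lmodType R) (f g : {linear tensor -> C}) :
  (forall a b, f (tens a b) = g (tens a b)) -> f =1 g.
Proof.
move=> fg t; have [u <-] := quot_proj_surj t.
apply: (free_lin_ext (f := f \o quot_proj _) (g := g \o quot_proj _)).
by case=> a b; apply: fg.
Qed.

End TensorProduct.

Section TensorMap.
Variables (J A B : lmodType R) (f : {linear A -> B}).

Let beta_fun (j : J) (a : A) : tensor J B := tens j (f a).

Fact tensor_map_bilinear : bilinear_for *:%R *:%R beta_fun.
Proof.
split=> [a r j j'|j r a a'] /=; rewrite /beta_fun.
  by rewrite linearPl.
by rewrite linearP linearPr.
Qed.

Let beta : {bilinear J -> A -> tensor J B} := HB.pack beta_fun
  (bilinear_isBilinear.Build R J A (tensor J B) _ _ beta_fun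
    tensor_map_bilinear).

Definition tensor_map : {linear tensor J A -> tensor J B} := tensor_lift beta.

Lemma tensor_mapE j a : tensor_map (tens j a) = tens j (f a).
Proof. exact: (tensor_liftE beta). Qed.

End TensorMap.
End Tensor.

Section HomologicalAlgebra.
Variable R : comNzRingType.

Definition noetherian : Prop :=
  forall I : submodule R^o, exists (n : nat) (a : 'I_n -> R),
    forall x : R, x \in submod_pred I <->
      exists c : 'I_n -> R, x = \sum_(i < n) c i * a i.

Definition exact_at (A B C : lmodType R)
    (f : {linear A -> B}) (g : {linear B -> C}) : Prop :=
  forall y : B, g y = 0 <-> exists x : A, f x = y.

Definition is_zero (V : lmodType R) : Prop := forall x : V, x = 0.

Definition projective (P : lmodType R) : Prop :=
  forall (A B : lmodType R) (p : {linear A -> B}) (f : {linear P -> B}),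
    (forall b : B, exists a : A, p a = b) ->
    exists g : {linear P -> A}, forall x, p (g x) = f x.

Definition injective_module (J : lmodType R) : Prop :=
  forall (A B : lmodType R) (i : {linear A -> B}) (f : {linear A -> J}),
    injective i -> exists g : {linear B -> J}, forall x, g (i x) = f x.

Definition flat (F : lmodType R) : Prop :=
  forall (A B C : lmodType R) (f : {linear A -> B}) (g : {linear B -> C}),
    exact_at f g -> exact_at (tensor_map F f) (tensor_map F g).

Record nat_complex := NatComplex {
  nobj :> nat -> lmodType R;
  ndiff : forall n, {linear nobj n.+1 -> nobj n} }.

Definition is_resolution (cls : lmodType R -> Prop) (M : lmodType R)
    (G : nat_complex) : Prop :=
  (forall n, cls (G n)) /\
  exists aug : {linear G 0 -> M},
    [/\ forall x : M, exists y, aug y = x,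
        exact_at (ndiff G 0) aug &
        forall n, exact_at (ndiff G n.+1) (ndiff G n)].

(* The supremum of the empty set is [-oo]: the zero module has dimension
   [-oo]. *)
Definition complex_length (G : nat_complex) : \bar int :=
  supremum -oo%E [set l | exists2 n : nat, ~ is_zero (G n) & l = n%:Z%:E].

Definition resolution_dim (cls : lmodType R -> Prop) (M : lmodType R) :
    \bar int :=
  infimum +oo%E
    [set l | exists2 G, is_resolution cls M G & l = complex_length G].

Definition fd : lmodType R -> \bar int := resolution_dim flat.

Record int_complex := IntComplex {
  zobj :> int -> lmodType R;
  zdiff : forall i, {linear zobj (i + 1) -> zobj i};
  zdiffK : forall i x, zdiff i (zdiff (i + 1) x) = 0 }.

Definition complete_flat_resolution (F : int_complex) : Prop :=
  [/\ forall i, flat (F i),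
      forall i, exact_at (zdiff F (i + 1)) (zdiff F i) &
      forall J, injective_module J -> forall i,
        exact_at (tensor_map J (zdiff F (i + 1))) (tensor_map J (zdiff F i))].

Definition gorenstein_flat (M : lmodType R) : Prop :=
  exists2 F, complete_flat_resolution F &
  exists (i : int) (h : {linear coker (zdiff F i) -> M}), bijective h.

Definition Gfd : lmodType R -> \bar int := resolution_dim gorenstein_flat.

(* H^i(Hom(P, K)) = 0; in degree 0 there are no coboundaries. *)
Definition hom_cohomology_eq0 (i : nat) (P : nat_complex) (K : lmodType R) :
    Prop :=
  forall g : {linear P i -> K},
    (forall x, g (ndiff P i x) = 0) ->
    match i return {linear P i -> K} -> Prop with
    | 0 => fun g => forall x, g x = 0
    | j.+1 => fun g =>
        exists h : {linear P j -> K}, forall x, g x = h (ndiff P j x)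
    end g.

(* Independent of the projective resolution, and one always exists by
   [projective_resolution_exists] below. *)
Definition Ext_eq0 (i : nat) (A K : lmodType R) : Prop :=
  forall P, is_resolution projective A P -> hom_cohomology_eq0 i P K.

Definition cotorsion (K : lmodType R) : Prop :=
  forall (i : nat) (F : lmodType R), (0 < i)%N -> flat F -> Ext_eq0 i F K.

Definition CF (K : lmodType R) : Prop := cotorsion K /\ (fd K < +oo)%E.

Definition CF_preenvelope (M K : lmodType R) (phi : {linear M -> K}) : Prop :=
  CF K /\
  forall Y : lmodType R, CF Y -> forall f : {linear M -> Y},
    exists g : {linear K -> Y}, forall x, g (phi x) = f x.

Lemma free_projective (X : choiceType) : projective (free_mod R X).
Proof.
move=> A B p f p_surj.
have /choice[s sP] (x : X) : exists a : A, p a = f (free_gen R x).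
  exact: p_surj.
exists (free_lift s); apply: (free_lin_ext (f := p \o free_lift s)) => x.
by rewrite /= free_liftE.
Qed.

Definition cover (A : lmodType R) (S : pred A) :
  {linear free_mod R {x : A | S x} -> A} := free_lift val.

Record arrow := Arrow {
  arrow_dom : lmodType R;
  arrow_cod : lmodType R;
  arrow_map :> {linear arrow_dom -> arrow_cod} }.

Definition next_arrow (f : arrow) : arrow :=
  Arrow (cover [pred x | f x == 0]).

Definition std_arrow (M : lmodType R) (n : nat) : arrow :=
  iter n next_arrow (Arrow (cover (A := M) predT)).

Definition std_resolution (M : lmodType R) : nat_complex :=
  @NatComplex (fun n => arrow_dom (std_arrow M n))
    (fun n => arrow_map (std_arrow M n.+1)).

Lemma cover_exact (A B : lmodType R) (f : {linear A -> B}) :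
  exact_at (cover [pred x | f x == 0]) f.
Proof.
move=> y; split=> [fy0|[u <-]].
  have Hy : [pred x | f x == 0] y by apply/eqP.
  by exists (free_gen R (exist _ y Hy)); rewrite free_liftE.
apply: (free_lin_ext (f := f \o cover _) (g := \0)) => -[x fx].
by rewrite /= free_liftE; apply/eqP.
Qed.

Lemma projective_resolution_exists (M : lmodType R) :
  is_resolution projective M (std_resolution M).
Proof.
split=> [n|]; first by case: n => [|n]; apply: free_projective.
exists (cover (A := M) predT); split=> [x||n].
- have Hx : (predT : pred M) x by [].
  by exists (free_gen R (exist _ x Hx)); rewrite free_liftE.
- exact: cover_exact.
- exact: cover_exact.
Qed.

End HomologicalAlgebra.

(* Main.v *)
Require Import Defs.
From HB Require Import structures.
From mathcomp Require Import all_boot all_order all_algebra.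
From mathcomp Require Import boolp classical_sets constructive_ereal.

Set Implicit Arguments.
Unset Strict Implicit.
Unset Printing Implicit Defensive.

Import Order.TTheory GRing.Theory Num.Theory.
Local Open Scope ring_scope.

(** Write [dual A] for the module of linear maps from [A] to the character
    module of the ring, i.e. the additive maps from the ring to the rationals
    modulo the integers.  The character module is an injective cogenerator, so
    [A] is flat if and only if [dual A] is injective ([flat_dual]), and
    tensoring a complex with [J] keeps it exact if and only if mapping the
    complex into [dual J] does ([tensor_exact_dual]).  This turns every tensor
    condition into the extendability of linear maps, and no derived functor
    beyond the vanishing of the first Ext is ever required: higher vanishing is
    replaced by classes of modules that are stable under syzygies.

    Noetherianity enters once: if [J] is injective then [dual J] is flat
    ([dual_flat]).  Hence a flat [F] embeds in the module [dual (dual F)],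
    which is flat, and cotorsion like every dual, and the cokernel is again
    flat ([flat_pure_embedding]).  Pushouts and induction on the length of a
    flat resolution propagate this: every module of flat dimension at most [n]
    embeds in a cotorsion module of flat dimension at most [n] with flat
    cokernel ([ex_cotorsion_embedding]) and, if [n] is positive, is the
    quotient of a flat module by a cotorsion module of flat dimension at most
    [n - 1] ([special_flat_precover]).

    The Gorenstein flat modules form the largest class [GF] whose members [X]
    embed in a flat module with cokernel in the class, are quotients of a flat
    module with kernel in the class, and satisfy Ext^1(X, dual J) = 0 for
    injective [J]: splicing the short exact sequences yields the complete flat
    resolution.  Coinduction then shows that [GF] is closed under extensions
    ([GF_ext]) and under kernels of epimorphisms from flat modules onto its
    members ([GF_kernel]).

    A module [M] with a Gorenstein flat resolution of length [n] embeds in some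
    [K0] of flat dimension at most [n] with Gorenstein flat cokernel
    ([GF_embedding]): push the last syzygy into a flat module and work back
    along the resolution, replacing each extension of Gorenstein flat modules
    by a flat module.  Embedding [K0] in a cotorsion module [K] only changes
    the cokernel [C] by an extension with a flat module.  The map from [M] to
    [K] is a preenvelope because Ext^1(C, Y) = 0 for [Y] cotorsion of finite
    flat dimension ([Ext1_GF_CF]).  Conversely a flat resolution of [K] pulls
    back to a Gorenstein flat resolution of [M] of the same length
    ([GF_dim_le_of_embedding]), so the two dimensions agree. *)

(** * Linear relations and submodules *)
Section LinearRelations.
Variable R : comNzRingType.
Implicit Types A B C D : lmodType R.

(** Graphs of partially defined linear maps: they allow diagram chases and
    extension arguments to name a map by what it relates before it is known to
    be single valued or everywhere defined. *)
Definition linear_rel A B (G : A -> B -> Prop) : Prop :=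
  G 0 0 /\ forall r a b a' b', G a b -> G a' b' ->
    G (r *: a + a') (r *: b + b').

Definition single_valued A B (G : A -> B -> Prop) : Prop :=
  forall b, G 0 b -> b = 0.

Lemma linear_relB A B (G : A -> B -> Prop) a b a' b' :
  linear_rel G -> G a b -> G a' b' -> G (a - a') (b - b').
Proof.
move=> [_ lin] Gab Ga'b'.
by rewrite -[a - a']addrC -[b - b']addrC -!scaleN1r; apply: lin.
Qed.

Lemma single_valued_eq A B (G : A -> B -> Prop) a b b' :
  linear_rel G -> single_valued G -> G a b -> G a b' -> b = b'.
Proof.
move=> lin sv Gab Gab'; apply/eqP; rewrite -subr_eq0; apply/eqP/sv.
by rewrite -(subrr a); apply: linear_relB.
Qed.

Lemma linear_of_rel A B (G : A -> B -> Prop) :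
    linear_rel G -> single_valued G -> (forall a, exists b, G a b) ->
  exists f : {linear A -> B}, forall a, G a (f a).
Proof.
move=> lin sv /choice[f fP].
have fL : linear f.
  move=> r a a'; apply: (single_valued_eq lin sv (fP _)).
  by case: lin => _; apply.
pose F : {linear A -> B} := HB.pack f (GRing.isLinear.Build R A B *:%R f fL).
by exists F.
Qed.

Lemma factor_epi A B C (g : {linear A -> B}) (h : {linear A -> C}) :
    (forall b, exists a, g a = b) -> (forall a, g a = 0 -> h a = 0) ->
  exists k : {linear B -> C}, forall a, k (g a) = h a.
Proof.
move=> gs gh.
have [|c [a [ga0 <-]]|b|k kP] :=
  @linear_of_rel B C (fun b c => exists a, g a = b /\ h a = c).
- split; first by exists 0; rewrite !linear0.
  move=> r _ _ _ _ [a [<- <-]] [a' [<- <-]].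
  by exists (r *: a + a'); rewrite !linearP.
- exact: gh.
- by have [a <-] := gs b; exists (h a), a.
exists k => a; have [a' [gaa' <-]] := kP (g a).
apply/eqP; rewrite -subr_eq0 -linearB; apply/eqP/gh.
by rewrite linearB gaa' subrr.
Qed.

Lemma factor_mono A B C (i : {linear A -> B}) (h : {linear C -> B}) :
    injective i -> (forall c, exists a, i a = h c) ->
  exists k : {linear C -> A}, forall c, i (k c) = h c.
Proof.
move=> ii hi.
have [|a|//|k kP] := @linear_of_rel C A (fun c a => i a = h c).
- split=> [|r a b a' b' e e']; first by rewrite !linear0.
  by rewrite !linearP e e'.
- by rewrite linear0 -[in RHS](linear0 i) => /ii.
by exists k.
Qed.

End LinearRelations.

Section SubmoduleType.
Variables (R : comNzRingType) (V : lmodType R) (P : V -> Prop).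

Record submod_type := SubMod { sub_val : V; sub_valP : P sub_val }.
HB.instance Definition _ := gen_eqMixin submod_type.
HB.instance Definition _ := gen_choiceMixin submod_type.

Lemma sub_val_inj : injective sub_val.
Proof.
by move=> [u Pu] [v Pv] /= uv; subst v; congr SubMod; apply: Prop_irrelevance.
Qed.

End SubmoduleType.

(** Gives kernels, preimages and domains of partial maps a module structure
    without a named type; only the injection and its image are ever used. *)
Lemma ex_submodule (R : comNzRingType) (V : lmodType R) (P : V -> Prop) :
    P 0 -> (forall r u v, P u -> P v -> P (r *: u + v)) ->
  exists (U : lmodType R) (i : {linear U -> V}),
    injective i /\ forall v, P v <-> exists u, i u = v.
Proof.
move=> P0 PL.
have PD u v : P u -> P v -> P (u + v) by move=> /(PL 1 _ v); rewrite scale1r.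
have PZ r u : P u -> P (r *: u) by move=> /(PL r _ 0)/(_ P0); rewrite addr0.
have PN u : P u -> P (- u) by rewrite -scaleN1r; apply: PZ.
pose T := submod_type P.
pose z : T := SubMod P0.
pose op (u : T) : T := SubMod (PN _ (sub_valP u)).
pose ad (u v : T) : T := SubMod (PD _ _ (sub_valP u) (sub_valP v)).
pose sc r (u : T) : T := SubMod (PZ r _ (sub_valP u)).
have adA : associative ad by move=> *; apply/sub_val_inj/addrA.
have adC : commutative ad by move=> *; apply/sub_val_inj/addrC.
have ad0 : left_id z ad by move=> *; apply/sub_val_inj/add0r.
have adN : left_inverse z op ad by move=> *; apply/sub_val_inj/addNr.
pose Z : zmodType := HB.pack T (GRing.isZmodule.Build T adA adC ad0 adN).
have scA a b (u : Z) : sc a (sc b u) = sc (a * b) u.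
  by apply/sub_val_inj/scalerA.
have sc1 : left_id 1 (sc : R -> Z -> Z).
  by move=> *; apply/sub_val_inj/scale1r.
have scDr : right_distributive (sc : R -> Z -> Z) +%R.
  by move=> *; apply/sub_val_inj/scalerDr.
have scDl (u : Z) : {morph (sc : R -> Z -> Z)^~ u : a b / a + b}.
  by move=> *; apply/sub_val_inj/scalerDl.
pose U : lmodType R := HB.pack T Z
  (GRing.Zmodule_isLmodule.Build R Z scA sc1 scDr scDl).
have vL : linear (@sub_val _ V P : U -> V) by [].
pose i : {linear U -> V} := HB.pack (@sub_val _ V P : U -> V)
  (GRing.isLinear.Build R U V *:%R (@sub_val _ V P : U -> V) vL).
exists U, i; split; first exact: sub_val_inj.
move=> v; split=> [Pv|[u <-]]; last exact: sub_valP.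
by exists (SubMod Pv : U).
Qed.

(** * Short exact sequences *)
Section ShortExact.
Variable R : comNzRingType.
Implicit Types A B C D E F K L M N P Q U V W X Y Z : lmodType R.

Definition ses A B C (f : {linear A -> B}) (g : {linear B -> C}) : Prop :=
  [/\ injective f, forall c, exists b, g b = c & exact_at f g].

(** Forgets the maps of an exact sequence: most constructions below only need
    to know that some maps exist. *)
Definition short_exact A B C : Prop :=
  exists (f : {linear A -> B}) (g : {linear B -> C}), ses f g.

Lemma linear_inj A B (f : {linear A -> B}) :
  (forall x, f x = 0 -> x = 0) -> injective f.
Proof.
move=> f0 x y fxy; apply/eqP; rewrite -subr_eq0; apply/eqP/f0.
by rewrite linearB fxy subrr.
Qed.

Lemma linear_inj0 A B (f : {linear A -> B}) x : injective f -> f x = 0 -> x = 0.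
Proof. by move=> fi fx0; apply: fi; rewrite linear0. Qed.

Lemma ses_comp0 A B C (f : {linear A -> B}) (g : {linear B -> C}) x :
  exact_at f g -> g (f x) = 0.
Proof. by move=> e; apply/e; exists x. Qed.

Lemma ses_factor_epi A B C (f : {linear A -> B}) (g : {linear B -> C}) D
    (h : {linear B -> D}) :
  ses f g -> (forall a, h (f a) = 0) ->
  exists k : {linear C -> D}, forall b, k (g b) = h b.
Proof. by move=> [_ gs e] hf; apply: factor_epi gs _ => b /e[a <-]. Qed.

Lemma ses_factor_mono A B C (f : {linear A -> B}) (g : {linear B -> C}) D
    (h : {linear D -> B}) :
  ses f g -> (forall d, g (h d) = 0) ->
  exists k : {linear D -> A}, forall d, f (k d) = h d.
Proof. by move=> [fi _ e] gh; apply: factor_mono fi _ => d; apply/e. Qed.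

Lemma ex_ker B C (g : {linear B -> C}) :
  exists (A : lmodType R) (f : {linear A -> B}), injective f /\ exact_at f g.
Proof.
have [|r u v gu gv|A [f [fi fP]]] := @ex_submodule R B (fun b => g b = 0).
- exact: linear0.
- by rewrite linearP gu gv scaler0 addr0.
- by exists A, f.
Qed.

Lemma ex_ses_ker B C (g : {linear B -> C}) :
  (forall c, exists b, g b = c) ->
  exists (A : lmodType R) (f : {linear A -> B}), ses f g.
Proof. by move=> gs; have [A [f [fi e]]] := ex_ker g; exists A, f. Qed.

Lemma coker_exact A B (f : {linear A -> B}) : exact_at f (quot_proj (im f)).
Proof.
move=> y; split=> [/quot_proj_eq0/asboolP//|fy].
by apply/quot_proj_eq0/asboolP.
Qed.

Lemma ses_coker A B (f : {linear A -> B}) :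
  injective f -> ses f (quot_proj (im f) : {linear B -> coker f}).
Proof. by split=> //; [apply: quot_proj_surj|apply: coker_exact]. Qed.

Definition zero_mod : lmodType R := coker (idfun : {linear R^o -> R^o}).

Lemma zero_modP : is_zero zero_mod.
Proof.
move=> x; have [y <-] := quot_proj_surj x.
by apply/coker_exact; exists y.
Qed.

Lemma ses_id0 A Z : is_zero Z ->
  ses (idfun : {linear A -> A}) (\0 : {linear A -> Z}).
Proof.
move=> Z0; split=> // [c|y]; first by exists 0; rewrite (Z0 c).
by split=> // _; exists y.
Qed.

Lemma ses_0id A Z : is_zero Z ->
  ses (\0 : {linear Z -> A}) (idfun : {linear A -> A}).
Proof.
move=> Z0; split=> [x y _|c|y /=]; first by rewrite (Z0 x) (Z0 y).
  by exists c.
by split=> [->|[x <-]]; first exists 0.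
Qed.

Lemma short_exact_id0 A : short_exact A A zero_mod.
Proof. by exists idfun, \0; apply/ses_id0/zero_modP. Qed.

Lemma short_exact_0id A : short_exact zero_mod A A.
Proof. by exists \0, idfun; apply/ses_0id/zero_modP. Qed.

Lemma pack_linear A B (f : A -> B) : linear f ->
  exists g : {linear A -> B}, forall x, g x = f x.
Proof.
move=> fL; pose F : {linear A -> B} :=
  HB.pack f (GRing.isLinear.Build R A B *:%R f fL).
by exists F.
Qed.

Lemma pairZD A B r (a a' : A) (b b' : B) :
  r *: (a, b) + (a', b') = (r *: a + a', r *: b + b').
Proof. by []. Qed.

(** The pushout of two monomorphisms from [A] is the cokernel of the map from
    [A] to the product with components [h] and [f].  With this sign convention
    the two composites from [A] are opposite to each other, which does not
    affect the exact sequences. *)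
Lemma pushout A B C D E :
    short_exact A B C -> short_exact A D E ->
  exists2 P, short_exact D P C & short_exact B P E.
Proof.
move=> [f [g [fi gs fg]]] [h [q [hi qs hq]]].
have [k kE] : exists k : {linear A -> (D * B)%type}, forall a, k a = (h a, f a).
  by apply: pack_linear => r x y; rewrite !linearP.
pose pi : {linear _ -> coker k} := quot_proj (im k).
have pi0 d b : pi (d, b) = 0 <-> exists a, h a = d /\ f a = b.
  rewrite (coker_exact k (d, b)).
  split=> [[a]|[a [<- <-]]]; last by exists a; rewrite kE.
  by rewrite kE => -[<- <-]; exists a.
have pis : forall c, exists x, pi x = c := @quot_proj_surj _ _ _.
have [d dE] : exists d : {linear D -> coker k}, forall x, d x = pi (x, 0).
  by apply: pack_linear => r x y; rewrite -linearP pairZD scaler0 addr0.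
have [b bE] : exists b : {linear B -> coker k}, forall x, b x = pi (0, x).
  by apply: pack_linear => r x y; rewrite -linearP pairZD scaler0 addr0.
have [c cE] : exists c : {linear coker k -> C}, forall x, c (pi x) = g x.2.
  have [[x y] /pi0[a [_ <-]]|c cE] := factor_epi (h := g \o snd) pis.
  - by rewrite /= (ses_comp0 _ fg).
  - by exists c => x; rewrite cE.
have [e eE] : exists e : {linear coker k -> E}, forall x, e (pi x) = q x.1.
  have [[x y] /pi0[a [<- _]]|e eE] := factor_epi (h := q \o fst) pis.
  - by rewrite /= (ses_comp0 _ hq).
  - by exists e => x; rewrite eE.
exists (coker k).
  exists d, c; split.
  - apply: linear_inj => x; rewrite dE => /pi0[a [<- /(linear_inj0 fi)->]].
    exact: linear0.
  - by move=> z; have [y <-] := gs z; exists (pi (0, y)); rewrite cE.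
  - move=> z; have [[x y] <-] := pis z; rewrite cE /=; split.
      move=> /fg[a <-]; exists (x - h a); rewrite dE.
      apply/eqP; rewrite -subr_eq0 -linearB; apply/eqP/pi0; exists (- a).
      by rewrite !linearN /= !sub0r addrAC subrr sub0r.
    move=> [w]; rewrite dE => /eqP.
    rewrite -subr_eq0 -linearB => /eqP/pi0[a /= [_]].
    by rewrite sub0r => e0; rewrite -[y]opprK -e0 -linearN (ses_comp0 _ fg).
exists b, e; split.
- apply: linear_inj => x; rewrite bE => /pi0[a [/(linear_inj0 hi)-> <-]].
  exact: linear0.
- by move=> z; have [y <-] := qs z; exists (pi (y, 0)); rewrite eE.
- move=> z; have [[x y] <-] := pis z; rewrite eE /=; split.
    move=> /hq[a <-]; exists (y - f a); rewrite bE.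
    apply/eqP; rewrite -subr_eq0 -linearB; apply/eqP/pi0; exists (- a).
    by rewrite !linearN /= !sub0r addrAC subrr sub0r.
  move=> [w]; rewrite bE => /eqP.
  rewrite -subr_eq0 -linearB => /eqP/pi0[a /= [+ _]].
  by rewrite sub0r => e0; rewrite -[x]opprK -e0 -linearN (ses_comp0 _ hq).
Qed.

(** The maps are recorded because [Ext1_criterion] extends a map along one
    sequence and restricts it along the other. *)
Lemma pullback_maps X P A X' P' (a : {linear X -> P}) (p : {linear P -> A})
    (b : {linear X' -> P'}) (p' : {linear P' -> A}) :
    ses a p -> ses b p' ->
  exists (W : lmodType R) (u : {linear W -> P}) (v : {linear W -> P'})
      (a' : {linear X' -> W}) (b' : {linear X -> W}),
    [/\ ses a' u, ses b' v,
        forall x, v (a' x) = b x & forall x, u (b' x) = a x].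
Proof.
move=> [ai ps ap] [bi p's bp'].
pose d : {linear (P * P')%type -> A} := (p \o fst) \- (p' \o snd).
have dE x : d x = p x.1 - p' x.2 by [].
have [W [w [wi wd]]] := ex_ker d.
have [u uE] : exists u : {linear W -> P}, forall x, u x = (w x).1.
  by apply: pack_linear => r x y; rewrite linearP.
have [v vE] : exists v : {linear W -> P'}, forall x, v x = (w x).2.
  by apply: pack_linear => r x y; rewrite linearP.
have wP x y : p x = p' y -> exists z, w z = (x, y).
  by move=> e; apply/wd; rewrite dE /= e subrr.
have wE z : p (w z).1 = p' (w z).2.
  by apply/eqP; rewrite -subr_eq0 -dE (ses_comp0 _ wd).
have [j jE] : exists j : {linear X' -> (P * P')%type}, forall x, j x = (0, b x).
  by apply: pack_linear => r x y; rewrite linearP pairZD scaler0 addr0.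
have [i iE] : exists i : {linear X -> (P * P')%type}, forall x, i x = (a x, 0).
  by apply: pack_linear => r x y; rewrite linearP pairZD scaler0 addr0.
have [|a' a'E] := factor_mono (h := j) wi.
  by move=> x; rewrite jE; apply: wP; rewrite linear0 (ses_comp0 _ bp').
have [|b' b'E] := factor_mono (h := i) wi.
  by move=> x; rewrite iE; apply: wP; rewrite linear0 (ses_comp0 _ ap).
exists W, u, v, a', b'; split.
- split.
  + apply: linear_inj => x a'x0; apply: (linear_inj0 bi).
    by have := a'E x; rewrite a'x0 linear0 jE => -[].
  + move=> x; have [y xy] := p's (p x).
    by have [z zE] := wP x y (esym xy); exists z; rewrite uE zE.
  + move=> z; split=> [uz0|[x <-]]; last by rewrite uE a'E jE.
    rewrite uE in uz0; have := wE z; rewrite uz0 linear0 => /esym/bp'[x bx].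
    by exists x; apply: wi; rewrite a'E jE bx -[0]uz0; case: (w z).
- split.
  + apply: linear_inj => x b'x0; apply: (linear_inj0 ai).
    by have := b'E x; rewrite b'x0 linear0 iE => -[].
  + move=> y; have [x xy] := ps (p' y).
    by have [z zE] := wP x y xy; exists z; rewrite vE zE.
  + move=> z; split=> [vz0|[x <-]]; last by rewrite vE b'E iE.
    rewrite vE in vz0; have := wE z; rewrite vz0 linear0 => /ap[x ax].
    by exists x; apply: wi; rewrite b'E iE ax -[X in (_, X)]vz0; case: (w z).
- by move=> x; rewrite vE a'E jE.
- by move=> x; rewrite uE b'E iE.
Qed.

Lemma pullback X P A X' P' :
    short_exact X P A -> short_exact X' P' A ->
  exists2 W, short_exact X' W P & short_exact X W P'.
Proof.
move=> [a [p ap]] [b [p' bp']].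
have [W [u [v [a' [b' [s1 s2 _ _]]]]]] := pullback_maps ap bp'.
by exists W; [exists a', u|exists b', v].
Qed.

(** For [K] inside [P] inside [P'], take [Y' = P'/K]. *)
Lemma compose_mono K P Y P' F :
    short_exact K P Y -> short_exact P P' F ->
  exists2 Y', short_exact K P' Y' & short_exact Y Y' F.
Proof.
move=> [k [p [ki ps kp]]] [j [q [ji qs jq]]].
have ci : injective (j \o k) by apply: inj_comp.
have [_ pis ce] := ses_coker ci.
set pi : {linear P' -> coker (j \o k)} := quot_proj _ in pis ce.
have [|y yE] := factor_epi (h := pi \o j) ps.
  by move=> x /kp[a <-] /=; rewrite (ses_comp0 _ ce).
have [|r rE] := factor_epi (h := q) pis.
  by move=> x /ce[a <-] /=; rewrite (ses_comp0 _ jq).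
exists (coker (j \o k)); first by exists (j \o k), pi; split.
exists y, r; split.
- apply: linear_inj => z; have [x <-] := ps z; rewrite yE /= => /ce[a] /=.
  by move=> /ji <-; rewrite (ses_comp0 _ kp).
- by move=> z; have [x <-] := qs z; exists (pi x); rewrite rE.
- move=> z; have [x <-] := pis z; rewrite rE; split.
    by move=> /jq[a <-]; exists (p a); rewrite yE.
  move=> [w]; have [a <-] := ps w; rewrite yE => e.
  have /ce[b /= xE] : pi (x - j a) = 0.
    by rewrite linearB -[RHS](subrr (pi x)); congr (_ - _); apply: e.
  by rewrite -[x](subrK (j a)) -xE linearD !(ses_comp0 _ jq) addr0.
Qed.

(** [X] is the inverse image of [M] in [P]. *)
Lemma preimage_maps L P K M C (l : {linear L -> P}) (p : {linear P -> K})
    (m : {linear M -> K}) (q : {linear K -> C}) :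
    ses l p -> ses m q ->
  exists (X : lmodType R) (x : {linear X -> P}) (y : {linear L -> X})
      (z : {linear X -> M}),
    [/\ ses x (q \o p), ses y z, forall t, x (y t) = l t
      & forall t, m (z t) = p (x t)].
Proof.
move=> [li ps lp] [mi qs mq].
have [X [x [xi xe]]] := ex_ker (q \o p).
have [|y yE] := factor_mono (h := l) xi.
  by move=> t; apply/xe; rewrite /= (ses_comp0 _ lp) linear0.
have [|z zE] := factor_mono (h := p \o x) mi.
  by move=> t; apply/mq; apply: (ses_comp0 _ xe).
exists X, x, y, z; split=> //.
- split=> // c; have [k <-] := qs c; have [t <-] := ps k.
  by exists t.
- split.
  + apply: linear_inj => t yt0; apply: (linear_inj0 li).
    by rewrite -yE yt0 linear0.
  + move=> t; have [s sE] := ps (m t).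
    have /xe[w wE] : (q \o p) s = 0 by rewrite /= sE (ses_comp0 _ mq).
    by exists w; apply: mi; rewrite zE /= wE.
  + move=> t; split=> [zt0|[s <-]].
      have /lp[s sE] : p (x t) = 0 by rewrite -[p _]zE zt0 linear0.
      by exists s; apply: xi; rewrite yE.
    by apply: (linear_inj0 mi); rewrite zE /= yE (ses_comp0 _ lp).
Qed.

Lemma preimage L P K M C :
    short_exact L P K -> short_exact M K C ->
  exists2 X, short_exact X P C & short_exact L X M.
Proof.
move=> [l [p lp]] [m [q mq]].
have [X [x [y [z [s1 s2 _ _]]]]] := preimage_maps lp mq.
by exists X; [exists x, (q \o p)|exists y, z].
Qed.

(** Projectivity of [Q] provides a lift of its map to [B]; together with the
    map through [A] it covers [B]. *)
Lemma horseshoe A B C A1 P C1 Q :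
    projective Q -> short_exact A B C ->
    short_exact A1 P A -> short_exact C1 Q C ->
  exists2 B1, short_exact B1 (P * Q)%type B & short_exact A1 B1 C1.
Proof.
move=> Qp [f [g [fi gs fg]]] [a1 [a [a1i as_ a1a]]] [c1 [c [c1i cs c1c]]].
have [s sE] := Qp _ _ g c gs.
pose d : {linear (P * Q)%type -> B} := (f \o (a \o fst)) \+ (s \o snd).
have dE x : d x = f (a x.1) + s x.2 by [].
have [B1 [k [ki ke]]] := ex_ker d.
have kE t : c (k t).2 = 0.
  have := ses_comp0 t ke; rewrite dE => /(congr1 g).
  by rewrite linearD (ses_comp0 _ fg) sE add0r linear0.
have [y yE] : exists y : {linear B1 -> C1}, forall t, c1 (y t) = (k t).2.
  have [k2 k2E] : exists k2 : {linear B1 -> Q}, forall t, k2 t = (k t).2.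
    by apply: pack_linear => r u v; rewrite linearP.
  have [t|y yE] := factor_mono (h := k2) c1i; last by exists y => t; rewrite yE.
  by rewrite k2E; apply/c1c.
have [x xE] : exists x : {linear A1 -> B1}, forall t, k (x t) = (a1 t, 0).
  have [k1 k1E] :
      exists k1 : {linear A1 -> (P * Q)%type}, forall t, k1 t = (a1 t, 0).
    apply: pack_linear => r u v; by rewrite linearP pairZD scaler0 addr0.
  have [t|x xE] := factor_mono (h := k1) ki.
    by apply/ke; rewrite dE k1E /= (ses_comp0 _ a1a) !linear0 addr0.
  by exists x => t; rewrite xE.
exists B1.
  exists k, d; split=> // b.
  have [q qE] := cs (g b).
  have /fg[a' a'E] : g (b - s q) = 0 by rewrite linearB sE qE subrr.
  have [p pE] := as_ a'; exists (p, q).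
  by rewrite dE /= pE a'E subrK.
exists x, y; split.
- apply: linear_inj => t xt0; apply: (linear_inj0 a1i).
  by have := xE t; rewrite xt0 linear0 => -[].
- move=> z; have /fg[a' a'E] : g (s (c1 z)) = 0.
    by rewrite sE (ses_comp0 _ c1c).
  have [p pE] := as_ a'.
  have /ke[t tE] : d (- p, c1 z) = 0.
    by rewrite dE /= linearN pE linearN a'E addNr.
  by exists t; apply: c1i; rewrite yE tE.
- move=> t; split=> [yt0|[w <-]]; last first.
    by apply: (linear_inj0 c1i); rewrite yE xE.
  have k2 : (k t).2 = 0 by rewrite -yE yt0 linear0.
  have := ses_comp0 t ke; rewrite dE k2 linear0 addr0 => /(linear_inj0 fi).
  move=> /a1a[w wE]; exists w; apply: ki; rewrite xE wE -[X in (_, X)]k2.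
  by case: (k t).
Qed.

(** The dual of [horseshoe]; the extension [t] of [u] to [B] plays the part of
    the lift. *)
Lemma cohorseshoe A B C F A' F' C' (f : {linear A -> B}) (g : {linear B -> C})
    (u : {linear A -> F}) (u' : {linear F -> A'}) (t : {linear B -> F}) :
    ses f g -> ses u u' -> short_exact C F' C' ->
    (forall a, t (f a) = u a) ->
  exists2 B', short_exact B (F * F')%type B' & short_exact A' B' C'.
Proof.
move=> [fi gs fg] [ui u's uu'] [v [v' [vi v's vv']]] tf.
have [k kE] :
    exists k : {linear B -> (F * F')%type}, forall b, k b = (t b, v (g b)).
  by apply: pack_linear => r x y; rewrite !linearP.
have ki : injective k.
  apply: linear_inj => b; rewrite kE => -[tb0 /(linear_inj0 vi)/fg[a ab]].
  by move: tb0; rewrite -ab tf => /(linear_inj0 ui) ->; rewrite linear0.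
have [_ pis pe] := ses_coker ki.
set pi : {linear _ -> coker k} := quot_proj _ in pis pe.
have [x xE] : exists x : {linear A' -> coker k}, forall z, x (u' z) = pi (z, 0).
  have [h hE] : exists h : {linear F -> coker k}, forall z, h z = pi (z, 0).
    apply: pack_linear => r y z; by rewrite -linearP pairZD scaler0 addr0.
  have [z /uu'[a <-]|x xE] := factor_epi (h := h) u's.
  - rewrite hE; apply/pe; exists (f a).
    by rewrite kE tf (ses_comp0 _ fg) linear0.
  - by exists x => z; rewrite xE.
have [y yE] : exists y : {linear coker k -> C'}, forall z, y (pi z) = v' z.2.
  have [z /pe[b <-]|y yE] := factor_epi (h := v' \o snd) pis.
  - by rewrite /= kE (ses_comp0 _ vv').
  - by exists y => z; rewrite yE.
exists (coker k); first by exists k, pi; split.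
exists x, y; split.
- apply: linear_inj => w; have [z <-] := u's w; rewrite xE => /pe[b].
  rewrite kE => -[<- /(linear_inj0 vi)/fg[a <-]].
  by rewrite tf (ses_comp0 _ uu').
- by move=> w; have [z <-] := v's w; exists (pi (0, z)); rewrite yE.
- move=> w; have [[z z'] <-] := pis w; rewrite yE /=; split.
    move=> /vv'[c <-]; have [b <-] := gs c; exists (u' (z - t b)).
    rewrite xE; apply/eqP; rewrite -subr_eq0 -linearB; apply/eqP/pe.
    exists (- b); rewrite kE !linearN; congr pair; rewrite /= ?sub0r //.
    by rewrite addrAC subrr sub0r.
  move=> [c]; have [e <-] := u's c; rewrite xE => h.
  have /pe[b] : pi ((z, z') - (e, 0)) = 0 by rewrite linearB h subrr.
  by rewrite kE => -[_]; rewrite subr0 => <-; rewrite (ses_comp0 _ vv').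
Qed.

End ShortExact.

(** * Extensions and injective modules *)
Section Ext1.
Variable R : comNzRingType.
Implicit Types A B C D E F J K L M N P Q U V W X Y Z : lmodType R.

(** Vanishing of Ext^1(A, K), as the possibility to extend maps to [K] along
    every monomorphism with cokernel [A]; this needs no resolution. *)
Definition Ext1_eq0 A K : Prop :=
  forall X Y (i : {linear X -> Y}) (p : {linear Y -> A}), ses i p ->
  forall f : {linear X -> K},
    exists g : {linear Y -> K}, forall x, g (i x) = f x.

(** One sequence ending at [A] suffices to test Ext^1(A, K) = 0 as soon as
    Ext^1(P, K) = 0 for its middle term: any other sequence is compared with it
    through the pullback [W].  After extending over [W], the restriction to the
    copy of [X] is corrected by a map defined on [P]. *)
Lemma Ext1_criterion X P A K (i : {linear X -> P}) (p : {linear P -> A}) :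
    ses i p -> Ext1_eq0 P K ->
    (forall f : {linear X -> K},
      exists g : {linear P -> K}, forall x, g (i x) = f x) ->
  Ext1_eq0 A K.
Proof.
move=> ip PK ext X' Y' i' p' ip' f.
have [W [u [v [a' [b' [s1 s2 va ub]]]]]] := pullback_maps ip ip'.
have [w wE] := PK _ _ _ _ s1 f.
have [e eE] := ext (w \o b').
pose d : {linear W -> K} := w \- (e \o u).
have dE x : d x = w x - e (u x) by [].
have [t|g gE] := ses_factor_epi (h := d) s2.
  by rewrite dE ub eE subrr.
exists g => x; rewrite -va gE dE wE; case: s1 => _ _ s1.
by rewrite (ses_comp0 _ s1) linear0 subr0.
Qed.

Lemma Ext1_extl A B C K (f : {linear A -> B}) (g : {linear B -> C}) :
  ses f g -> Ext1_eq0 A K -> Ext1_eq0 C K -> Ext1_eq0 B K.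
Proof.
move=> fg AK CK X Y i p ip h.
have [Z [x [y [z [s1 s2 xy _]]]]] := preimage_maps ip fg.
have [h1 h1E] := AK _ _ _ _ s2 h; have [h2 h2E] := CK _ _ _ _ s1 h1.
by exists h2 => t; rewrite -xy h2E h1E.
Qed.

Lemma Ext1_projective P K : projective P -> Ext1_eq0 P K.
Proof.
move=> Pp X Y i p ip f; have [_ ps _] := ip.
have [s sE] := Pp _ _ p (idfun : {linear P -> P}) ps.
pose d : {linear Y -> Y} := idfun \- (s \o p).
have dE y : d y = y - s (p y) by [].
have [t|k kE] := ses_factor_mono (h := d) ip.
  by rewrite dE linearB sE subrr.
exists (f \o k) => x /=; congr (f _); have [ii _ e] := ip; apply: ii.
by rewrite kE dE (ses_comp0 _ e) linear0 subr0.
Qed.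

Lemma ex_projective_cover A :
  exists X P (i : {linear X -> P}) (p : {linear P -> A}),
    ses i p /\ projective P.
Proof.
have [|X [i ip]] := @ex_ses_ker R _ A (Defs.cover (A := A) predT).
  move=> a; have Pa : (predT : pred A) a by [].
  by exists (free_gen R (exist _ a Pa)); rewrite free_liftE.
exists X, _, i, (Defs.cover (A := A) predT); split => //.
exact: free_projective.
Qed.

Lemma Ext1_lift A K P Y (i : {linear K -> P}) (p : {linear P -> Y})
    (f : {linear A -> Y}) :
  ses i p -> Ext1_eq0 A K ->
  exists g : {linear A -> P}, forall a, p (g a) = f a.
Proof.
move=> ip AK; have [X [Q [j [q [jq Qp]]]]] := ex_projective_cover A.
have [_ ps _] := ip; have [_ _ ejq] := jq.
have [v vE] := Qp _ _ p (f \o q) ps.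
have [t|w wE] := ses_factor_mono (h := v \o j) ip.
  by rewrite /= vE /= (ses_comp0 _ ejq) linear0.
have [w' w'E] := AK _ _ _ _ jq w.
pose d : {linear Q -> P} := v \- (i \o w').
have dE x : d x = v x - i (w' x) by [].
have [t|g gE] := ses_factor_epi (h := d) jq.
  by rewrite dE w'E wE /= subrr.
exists g => a; have [_ qs _] := jq; have [x <-] := qs a.
have [_ _ e] := ip.
by rewrite gE dE linearB vE (ses_comp0 _ e) subr0.
Qed.

Lemma Ext1_extr A K P Y :
  short_exact K P Y -> Ext1_eq0 A K -> Ext1_eq0 A Y -> Ext1_eq0 A P.
Proof.
move=> [k [p kp]] AK AY; have [X [Q [j [q [jq Qp]]]]] := ex_projective_cover A.
apply: (Ext1_criterion jq (Ext1_projective Qp)) => f.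
have [u uE] := AY _ _ _ _ jq (p \o f).
have [_ ps e] := kp; have [v vE] := Qp _ _ p u ps.
pose d : {linear X -> P} := f \- (v \o j).
have dE x : d x = f x - v (j x) by [].
have [t|w wE] := ses_factor_mono (h := d) kp.
  by rewrite dE linearB vE uE subrr.
have [w' w'E] := AK _ _ _ _ jq w.
pose h : {linear Q -> P} := v \+ (k \o w').
have hE x : h x = v x + k (w' x) by [].
by exists h => x; rewrite hE w'E wE dE addrC subrK.
Qed.

(** Dimension shifting without Ext^2: a map from the syzygy [A1] to [Y] lifts
    to [P] because Ext^1(A1, K) = 0, and the lift extends to [Q]. *)
Lemma Ext1_coker A A1 Q K P Y :
    short_exact A1 Q A -> projective Q -> short_exact K P Y ->
    Ext1_eq0 A1 K -> Ext1_eq0 A P ->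
  Ext1_eq0 A Y.
Proof.
move=> [j [q jq]] Qp [k [p kp]] AK AP.
apply: (Ext1_criterion jq (Ext1_projective Qp)) => f.
have [g gE] := Ext1_lift f kp AK; have [h hE] := AP _ _ _ _ jq g.
by exists (p \o h) => x /=; rewrite hE gE.
Qed.

Lemma Ext1_retract A Y Y' (i : {linear Y -> Y'}) (r : {linear Y' -> Y}) :
  (forall y, r (i y) = y) -> Ext1_eq0 A Y' -> Ext1_eq0 A Y.
Proof.
move=> ri AY' X Z j q jq f; have [g gE] := AY' _ _ _ _ jq (i \o f).
by exists (r \o g) => x /=; rewrite gE /= ri.
Qed.

(** Maps into an injective module may be prescribed on any submodule by a
    relation, without naming the submodule. *)
Lemma injective_extend J A (G : A -> J -> Prop) :
    injective_module J -> linear_rel G -> single_valued G ->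
  exists g : {linear A -> J}, forall a b, G a b -> g a = b.
Proof.
move=> Jinj lin sv.
have [||U [i [ii iP]]] := @ex_submodule R A (fun a => exists b, G a b).
- by exists 0; case: lin.
- move=> r u v [b Gb] [c Gc]; exists (r *: b + c).
  by case: lin => _; apply.
have [||x|f fP] := @linear_of_rel R U J (fun u b => G (i u) b).
- split=> [|r a b a' b' Gb Gb']; first by rewrite linear0; case: lin.
  by rewrite linearP; case: lin => _; apply.
- by move=> b; rewrite linear0; apply: sv.
- by apply/iP; exists x.
have [g gE] := Jinj _ _ i f ii.
exists g => a b Gab; have /iP[u ua] : exists b, G a b by exists b.
rewrite -ua gE; apply: (single_valued_eq lin sv (fP u)).
by rewrite ua.
Qed.

Lemma injective_retract J J' (i : {linear J -> J'}) (r : {linear J' -> J}) :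
  (forall y, r (i y) = y) -> injective_module J' -> injective_module J.
Proof.
move=> ri J'inj A B j f ji; have [g gE] := J'inj _ _ j (i \o f) ji.
by exists (r \o g) => x /=; rewrite gE /= ri.
Qed.

(* a short exact sequence is split by a retraction or by a section *)
Lemma split_section A B C (f : {linear A -> B}) (g : {linear B -> C})
    (r : {linear B -> A}) :
    ses f g -> (forall a, r (f a) = a) ->
  exists s : {linear C -> B},
    (forall c, g (s c) = c) /\ forall b, b = f (r b) + s (g b).
Proof.
move=> fg rf.
pose d : {linear B -> B} := idfun \- (f \o r).
have dE x : d x = x - f (r x) by [].
have [a|s sE] := ses_factor_epi (h := d) fg; first by rewrite dE rf subrr.
have [_ gs e] := fg.
exists s; split=> [c|b]; last by rewrite sE dE addrC subrK.
by have [b <-] := gs c; rewrite sE dE linearB (ses_comp0 _ e) subr0.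
Qed.

Lemma split_retraction A B C (f : {linear A -> B}) (g : {linear B -> C})
    (s : {linear C -> B}) :
    ses f g -> (forall c, g (s c) = c) ->
  exists r : {linear B -> A}, forall a, r (f a) = a.
Proof.
move=> fg gs.
pose d : {linear B -> B} := idfun \- (s \o g).
have dE x : d x = x - s (g x) by [].
have [b|r rE] := ses_factor_mono (h := d) fg.
  by rewrite dE linearB gs subrr.
have [fi _ e] := fg; exists r => a; apply: fi.
by rewrite rE dE (ses_comp0 _ e) linear0 subr0.
Qed.

Lemma injective_ses_split A B C (f : {linear A -> B}) (g : {linear B -> C}) :
  ses f g -> injective_module A ->
  exists r : {linear B -> A}, forall a, r (f a) = a.
Proof. by move=> [fi _ _] Ainj; apply: (Ainj _ _ f idfun fi). Qed.

Lemma injective_ext A B C :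
  short_exact A B C -> injective_module A -> injective_module C ->
  injective_module B.
Proof.
move=> [f [g fg]] Ai Ci; have [r rf] := injective_ses_split fg Ai.
have [s [_ bE]] := split_section fg rf.
move=> X Y i h ii; have [h1 h1E] := Ai _ _ i (r \o h) ii.
have [h2 h2E] := Ci _ _ i (g \o h) ii.
pose k : {linear Y -> B} := (f \o h1) \+ (s \o h2).
have kE y : k y = f (h1 y) + s (h2 y) by [].
by exists k => x; rewrite kE h1E h2E /= -bE.
Qed.

Lemma injective_coker A B C :
  short_exact A B C -> injective_module A -> injective_module B ->
  injective_module C.
Proof.
move=> [f [g fg]] Ai Bi; have [r rf] := injective_ses_split fg Ai.
have [s [gs _]] := split_section fg rf.
exact: injective_retract gs Bi.
Qed.

End Ext1.

(** * Modules of linear maps *)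
Section HomModule.
Variables (R : comNzRingType) (A E : lmodType R).

Record hom_mod := HomMod { hom_fun :> A -> E; hom_linear : linear hom_fun }.
HB.instance Definition _ := gen_eqMixin hom_mod.
HB.instance Definition _ := gen_choiceMixin hom_mod.
HB.instance Definition _ (f : hom_mod) :=
  GRing.isLinear.Build R A E *:%R (hom_fun f) (hom_linear f).

Lemma hom_ext (f g : hom_mod) : (forall a, f a = g a) -> f = g.
Proof.
case: f g => f fL [g gL] /= /funext fg; subst g.
by congr HomMod; apply: Prop_irrelevance.
Qed.

Definition hom_of (f : {linear A -> E}) : hom_mod :=
  HomMod (@linearP _ _ _ _ f).

Fact hom_zero_linear : linear (fun _ : A => 0 : E).
Proof. by move=> r a b; rewrite scaler0 addr0. Qed.
Fact hom_opp_linear (f : hom_mod) : linear (fun a => - f a).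
Proof. by move=> r a b; rewrite linearP opprD scalerN. Qed.
Fact hom_add_linear (f g : hom_mod) : linear (fun a => f a + g a).
Proof. by move=> r a b; rewrite !linearP scalerDr addrACA. Qed.
Fact hom_scale_linear k (f : hom_mod) : linear (fun a => k *: f a).
Proof. by move=> r a b; rewrite linearP scalerDr !scalerA mulrC. Qed.

Definition hom_add f g := HomMod (hom_add_linear f g).
Definition hom_opp f := HomMod (hom_opp_linear f).
Definition hom_scale k f := HomMod (hom_scale_linear k f).

Fact hom_addA : associative hom_add.
Proof. by move=> f g h; apply: hom_ext => a; apply: addrA. Qed.
Fact hom_addC : commutative hom_add.
Proof. by move=> f g; apply: hom_ext => a; apply: addrC. Qed.
Fact hom_add0 : left_id (HomMod hom_zero_linear) hom_add.
Proof. by move=> f; apply: hom_ext => a; apply: add0r. Qed.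
Fact hom_addN : left_inverse (HomMod hom_zero_linear) hom_opp hom_add.
Proof. by move=> f; apply: hom_ext => a; apply: addNr. Qed.
HB.instance Definition _ :=
  GRing.isZmodule.Build hom_mod hom_addA hom_addC hom_add0 hom_addN.

Fact hom_scaleA k l (f : hom_mod) :
  hom_scale k (hom_scale l f) = hom_scale (k * l) f.
Proof. by apply: hom_ext => a; apply: scalerA. Qed.
Fact hom_scale1 : left_id 1 hom_scale.
Proof. by move=> f; apply: hom_ext => a; apply: scale1r. Qed.
Fact hom_scaleDr : right_distributive hom_scale +%R.
Proof. by move=> k f g; apply: hom_ext => a; apply: scalerDr. Qed.
Fact hom_scaleDl (f : hom_mod) : {morph hom_scale^~ f : k l / k + l}.
Proof. by move=> k l; apply: hom_ext => a; apply: scalerDl. Qed.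
HB.instance Definition _ := GRing.Zmodule_isLmodule.Build R hom_mod
  hom_scaleA hom_scale1 hom_scaleDr hom_scaleDl.

Lemma homD (f g : hom_mod) a : (f + g) a = f a + g a. Proof. by []. Qed.
Lemma homZ k (f : hom_mod) a : (k *: f) a = k *: f a. Proof. by []. Qed.

End HomModule.


(** * Baer's criterion and finite generation of relations *)
Section Baer.
Variable R : comNzRingType.
Implicit Types A B J : lmodType R.

(** Baer's criterion: among the single valued linear relations that contain the
    given partial map take a maximal one; if it were not defined at [b0], the
    ideal of the scalars [c] such that it is defined at [c *: b0] would allow
    one to extend it to [b0]. *)
Lemma baer J :
    (forall G : R^o -> J -> Prop, linear_rel G -> single_valued G ->
      exists x, forall c b, G c b -> b = c *: x) ->
  injective_module J.
Proof.
move=> Jext A B i f ii.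
pose G0 b y := exists a, i a = b /\ f a = y.
have G0lin : linear_rel G0.
  split; first by exists 0; rewrite !linear0.
  move=> r _ _ _ _ [a [<- <-]] [a' [<- <-]].
  by exists (r *: a + a'); rewrite !linearP.
have G0sv : single_valued G0.
  by move=> _ [a [/(linear_inj0 ii)-> <-]]; rewrite linear0.
pose P (S : set (B * J)) :=
  let G b y := G0 b y \/ S (b, y) in linear_rel G /\ single_valued G.
(* [S] only records what is added to [G0], so that the empty chain has an
   upper bound *)
have [F FP Ftot|S [[Glin Gsv] Smax]] := @Zorn_bigcup _ P.
  split.
    split; first by left; case: G0lin.
    have [_ G0l] := G0lin.
    have inF X r a b a' b' :
        F X -> G0 a b \/ X (a, b) -> G0 a' b' \/ X (a', b') ->
        G0 (r *: a + a') (r *: b + b') \/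
        (\bigcup_(X in F) X)%classic (r *: a + a', r *: b + b').
      move=> FX Xa Xa'; have [[_ Xl] _] := FP _ FX.
      by case: (Xl r a b a' b' Xa Xa') => [|?]; [left|right; exists X].
    move=> r a b a' b' [Gab|[X FX Xab]] [Gab'|[Y FY Yab']].
    - by left; apply: G0l.
    - by apply: (inF Y) => //; [left|right].
    - by apply: (inF X) => //; [right|left].
    - have [XY|YX] := Ftot _ _ FX FY.
        by apply: (inF Y) => //; right=> //; apply: XY.
      by apply: (inF X) => //; right=> //; apply: YX.
  by move=> b [/G0sv//|[X FX Xb]]; have [_ Xsv] := FP _ FX; apply: Xsv; right.
pose G b y := G0 b y \/ S (b, y).
have Gdom b0 : exists y, G b0 y.
  have [_ Gl] := Glin.
  have [||x xP] := Jext (fun c y => G (c *: b0) y).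
  - split=> [|r a b a' b' Gab Gab']; first by rewrite scale0r; case: Glin.
    by rewrite scalerDl -scalerA; apply: Gl.
  - by move=> b; rewrite scale0r; apply: Gsv.
  pose G' b y := exists c u v, [/\ G u v, b = u + c *: b0 & y = v + c *: x].
  have GG' b y : G b y -> G' b y.
    by move=> Gby; exists 0, b, y; rewrite !scale0r !addr0.
  have G'lin : linear_rel G'.
    split; first by apply: GG'; case: Glin.
    move=> r _ _ _ _ [c [u [v [Guv -> ->]]]] [c' [u' [v' [Guv' -> ->]]]].
    exists (r * c + c'), (r *: u + u'), (r *: v + v').
    by split; [exact: Gl|rewrite scalerDr scalerDl scalerA addrACA..].
  have G'sv : single_valued G'.
    move=> _ [c [u [v [Guv e ->]]]].
    have uE : u = (- c) *: b0.
      by rewrite scaleNr; apply/eqP; rewrite -addr_eq0 -e.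
    have -> : v = (- c) *: x by apply: xP; rewrite -uE.
    by rewrite scaleNr addNr.
  have PG' : P (fun p => G' p.1 p.2).
    rewrite /P /=; have -> : (fun b y => G0 b y \/ G' b y) = G'.
      apply/funext => b; apply/funext => y; apply/propext; split=> [[?|//]|].
        by apply: GG'; left.
      by right.
    by [].
  apply: contrapT => nG; apply: (Smax _ _ PG'); split.
    by move=> [b y] Sby /=; apply: GG'; right.
  move=> sub; apply: nG; exists x; right; apply: sub => /=.
  by exists 1, 0, 0; rewrite !scale1r !add0r; split=> //; case: Glin.
have [g gP] := linear_of_rel Glin Gsv Gdom.
exists g => a; apply: (single_valued_eq Glin Gsv (gP _)).
by left; exists a.
Qed.

(** Submodules of a finite free module are encoded as predicates on infinite
    sequences, so that the induction on the rank changes no type.  Closure is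
    phrased up to pointwise equality of sequences. *)
Definition comb_closed (P : (nat -> R) -> Prop) : Prop :=
  (forall w, (forall k, w k = 0) -> P w) /\
  forall r u v w, P u -> P v -> (forall k, w k = r * u k + v k) -> P w.

Lemma comb_closed_sum P (I : finType) (c : I -> R) (u : I -> nat -> R) w :
    comb_closed P -> (forall i, P (u i)) ->
    (forall k, w k = \sum_i c i * u i k) -> P w.
Proof.
move=> [P0 PL] Pu.
elim: (index_enum I) w => [|i s IHs] w wE.
  by apply: P0 => k; rewrite wE big_nil.
apply: (PL (c i) (u i) (fun k => \sum_(j <- s) c j * u j k)) => // [|k].
  exact: IHs.
by rewrite wE big_cons.
Qed.

(** Submodules of finite free modules over a noetherian ring are finitely
    generated.  Induction on the rank: the last coordinates of the elements of
    [S] form an ideal, and subtracting combinations of lifts of its generators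
    leads to elements whose last coordinate is zero.  Generation is expressed
    by the corresponding induction principle. *)
Lemma noetherian_submod_fg n (S : (nat -> R) -> Prop) :
    noetherian R -> comb_closed S ->
    (forall s, S s -> forall k, (n <= k)%N -> s k = 0) ->
  exists (I : finType) (r : I -> nat -> R),
    (forall i, S (r i)) /\
    forall T, comb_closed T -> (forall i, T (r i)) -> forall s, S s -> T s.
Proof.
move=> noeth; elim: n S => [|n IHn] S [S0 SL] Ssupp.
  exists 'I_0, (fun _ _ => 0); split=> [[]//|T [T0 _] _ s Ss].
  by apply: T0 => k; apply: Ssupp.
have Icl : submod_closed [pred x : R^o | `[< exists2 s, S s & s n = x >]].
  split=> [|r _ _ /asboolP[u Su <-] /asboolP[v Sv <-]]; apply/asboolP.
    by exists (fun _ => 0) => //; apply: S0.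
  by exists (fun k => r * u k + v k) => //; apply: (SL r u v).
have [m [a aP]] := noeth (Submodule Icl).
have /choice[t tP] (i : 'I_m) : exists s, S s /\ s n = a i.
  have /aP/asboolP[s Ss sn] : exists c : 'I_m -> R, a i = \sum_j c j * a j.
    exists (fun j => (j == i)%:R).
    rewrite (bigD1 i) //= eqxx mul1r big1 ?addr0 //.
    by move=> j /negPf->; rewrite mul0r.
  by exists s.
have [||J [r [Sr rP]]] := IHn (fun s => S s /\ s n = 0).
- split=> [w w0|c u v w [Su un] [Sv vn] wE]; first by split=> //; apply: S0.
  by split; [exact: (SL c u v)|rewrite wE un vn mulr0 addr0].
- move=> s [Ss sn] k; rewrite leq_eqVlt => /orP[/eqP<-//|]; exact: Ssupp.
exists ('I_m + J)%type, (fun i => match i with inl j => t j | inr j => r j end).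
split=> [[i|j]|T Tcl Tr s Ss].
- by case: (tP i).
- by case: (Sr j).
have /aP[c sn] : s n \in submod_pred (Submodule Icl).
  by apply/asboolP; exists s.
pose w k := \sum_i c i * t i k.
have Sw : S w by apply: (@comb_closed_sum S _ c t) => // i; case: (tP i).
have Tw : T w.
  by apply: (@comb_closed_sum T _ c t) => // i; apply: (Tr (inl i)).
have [_ TL] := Tcl.
(* [s] differs from [w] by an element whose last coordinate vanishes *)
apply: (TL 1 w (fun k => -1 * w k + s k)) => // [|k]; last first.
  by rewrite mul1r mulN1r addNKr.
apply: rP => //; first by move=> j; apply: (Tr (inr j)).
split; first by apply: (SL (-1) w s).
rewrite sn mulN1r /w; apply/eqP; rewrite addrC subr_eq0; apply/eqP.
by apply: eq_bigr => i _; case: (tP i) => _ ->.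
Qed.

End Baer.

(** * An injective cogenerator *)
Section RationalsModIntegers.
Local Notation "M ^z" := (zmodule M) (at level 2, format "M ^z") : type_scope.

Lemma int_ideal_principal (P : int -> Prop) :
    P 0 -> (forall k m n, P m -> P n -> P (k * m + n)) ->
  exists d : nat, forall n, P n <-> exists k, n = k * d%:Z.
Proof.
move=> P0 PL.
have PZ k m : P m -> P (k * m) by move=> Pm; rewrite -[k * m]addr0; apply: PL.
have [[m [m0 Pm]]|nP] := pselect (exists m : nat, (0 < m)%N /\ P m%:Z).
  have exm : exists m : nat, (0 < m)%N && `[< P m%:Z >].
    by exists m; rewrite m0; apply/asboolP.
  case: (ex_minnP exm) => d /andP[d0 /asboolP Pd] dmin.
  exists d => n; split=> [Pn|[k ->]]; last exact: PZ.
  exists (n %/ d)%Z.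
  have Pr : P (n %% d)%Z.
    rewrite [modz _ _](_ : _ = - (n %/ d)%Z * d%:Z + n); first exact: PL.
    by rewrite {3}(divz_eq n d) addrA mulNr addNr add0r.
  have d0' : (d%:Z != 0) by rewrite eqz_nat -lt0n.
  have := modz_ge0 n d0'; have := ltz_pmod n (d := d) d0.
  move: (divz_eq n d) Pr; case: (n %% d)%Z => // -[|r] nE Pr rd _.
    by rewrite {1}nE addr0.
  have : (d <= r.+1)%N by apply: dmin; rewrite /=; apply/asboolP.
  by rewrite leqNgt -ltz_nat rd.
exists 0 => n; split=> [Pn|[k ->]]; last by rewrite mulr0.
exists 0; rewrite mul0r; case: n Pn => [[//|n]|n] Pn.
  by case: nP; exists n.+1.
case: nP; exists n.+1; split=> //.
by have := PZ (-1) _ Pn; rewrite NegzE mulrN mulN1r opprK.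
Qed.

Definition int_rat (n : int^o) : rat^z := n%:~R.
Fact int_rat_linear : linear int_rat.
Proof.
by move=> r m n; rewrite /int_rat rmorphD rmorphM /= scalezrE mulrzl.
Qed.
HB.instance Definition _ :=
  GRing.isLinear.Build int int^o rat^z *:%R int_rat int_rat_linear.

Definition QZ : lmodType int := coker int_rat.
Definition QZ_pi : {linear rat^z -> QZ} := quot_proj (im int_rat).

Lemma QZ_divisible (d : nat) (b : QZ) : (0 < d)%N -> exists x, d%:Z *: x = b.
Proof.
move=> d0; have [q <-] := quot_proj_surj b.
exists (QZ_pi (q / d%:R : rat)); rewrite -linearZ; congr (QZ_pi _).
by rewrite scalezrE -mulrzl mulrC -pmulrn divfK // pnatr_eq0 -lt0n.
Qed.

(** Baer's criterion: ideals of the integers are principal, and the target is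
    divisible. *)
Lemma QZ_injective : injective_module QZ.
Proof.
apply: baer => G Glin Gsv; have [G0 GL] := Glin.
have [||d dP] := @int_ideal_principal (fun n => exists b, G n b).
- by exists 0.
- by move=> k m n [b Gb] [b' Gb']; exists (k *: b + b'); apply: GL.
have [b0 Gb0] : exists b, G d%:Z b by apply/dP; exists 1; rewrite mul1r.
have [x xE] : exists x, d%:Z *: x = b0.
  case: (posnP d) => [d0|]; last exact: QZ_divisible.
  by exists 0; rewrite scaler0; move: Gb0; rewrite d0 => /Gsv.
exists x => c b Gcb; have [k cE] : exists k, c = k * d%:Z by apply/dP; exists b.
apply: (single_valued_eq Glin Gsv Gcb); rewrite cE -scalerA xE.
by rewrite -[k * d]addr0 -[k *: b0]addr0; apply: GL.
Qed.

(** The cyclic group generated by [x] maps [x] to 1/e, where [e] is its order,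
    or 2 if the order is infinite; injectivity extends this map. *)
Lemma QZ_cogenerator (A : zmodType) (x : A) : x <> 0 ->
  exists f : {linear A^z -> QZ}, f x <> 0.
Proof.
move=> x0.
have [||d dP] := @int_ideal_principal (fun n => x *~ n = 0).
- exact: mulr0z.
- by move=> k m n xm xn; rewrite mulrzDr mulrC mulrzA xm mul0rz add0r.
pose e := if d == 0%N then 2 else d.
have e1 : (1 < e)%N.
  rewrite /e {e}; case: d dP => [|[|d]] //= dP.
  by case: x0; rewrite -[x]mulr1z; apply/dP; exists 1.
have de n : x *~ n = 0 -> exists k, n = k * e%:Z.
  move=> /dP; rewrite /e; case: eqP => [-> [k ->]|//].
  by exists 0; rewrite mulr0 mul0r.
have en0 : e%:R != 0 :> rat by rewrite pnatr_eq0 -lt0n ltnW.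
pose c := QZ_pi (e%:R^-1 : rat).
have c0 : c <> 0.
  move=> /coker_exact[n]; rewrite /= /int_rat.
  move=> /(congr1 (fun y : rat => y * e%:R)).
  rewrite mulVf // -[e%:R]/(e%:Z%:~R) -rmorphM -[RHS]/(1%:~R) => /intr_inj.
  move=> /(congr1 absz); rewrite abszM /= => /eqP.
  by rewrite muln_eq1 => /andP[_ /eqP e1']; rewrite e1' in e1.
have [||f fP] := injective_extend (A := A^z)
  (G := fun y q => exists n : int, y = x *~ n /\ q = n *: c) QZ_injective.
- split; first by exists 0; rewrite mulr0z scale0r.
  move=> r _ _ _ _ [n [-> ->]] [n' [-> ->]]; exists (r * n + n').
  split; last by rewrite scalerDl scalerA.
  by rewrite mulrzDr mulrC mulrzA.
- move=> q [n [/esym/de[k ->] ->]].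
  rewrite /c -linearZ.
  apply: (proj2 (@coker_exact _ _ _ (int_rat : {linear _ -> _}) _)); exists k.
  by rewrite /= /int_rat scalezrE -[RHS]mulrzl intrM mulfK.
exists f; rewrite (fP x c) //; exists 1.
by rewrite mulr1z scale1r.
Qed.

End RationalsModIntegers.

Section CharacterModule.
Variable R : comNzRingType.
Local Notation "M ^z" := (zmodule M) (at level 2, format "M ^z") : type_scope.

(** The additive maps from [R] to Q/Z, on which [r] acts by precomposition with
    multiplication by [r]. *)
Definition char_mod := hom_mod R^z QZ.
HB.instance Definition _ := GRing.Zmodule.on char_mod.

Fact char_scale_linear (r : R) (f : char_mod) :
  linear (fun s : R^z => f ((s : R) * r : R)).
Proof.
move=> n s t; rewrite -linearP; congr (f _).
by rewrite !scalezrE mulrDl mulrzAl.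
Qed.
Definition char_scale r f : char_mod := HomMod (char_scale_linear r f).

Fact char_scaleA r s f : char_scale r (char_scale s f) = char_scale (r * s) f.
Proof. by apply: hom_ext => t /=; rewrite mulrA. Qed.
Fact char_scale1 : left_id 1 char_scale.
Proof. by move=> f; apply: hom_ext => t /=; rewrite mulr1. Qed.
Fact char_scaleDr : right_distributive char_scale +%R.
Proof. by move=> r f g; apply: hom_ext. Qed.
Fact char_scaleDl f : {morph char_scale^~ f : r s / r + s}.
Proof. by move=> r s; apply: hom_ext => t /=; rewrite mulrDr linearD. Qed.
HB.instance Definition _ := GRing.Zmodule_isLmodule.Build R char_mod
  char_scaleA char_scale1 char_scaleDr char_scaleDl.

(** An additive map on [A] with values in Q/Z is the same thing as a linear map
    to [char_mod], through evaluation at 1.  This transports injectivity and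
    cogeneration from Q/Z to [char_mod]. *)
Lemma char_coinduction (A : lmodType R) (gamma : {linear A^z -> QZ}) :
  exists g : {linear A -> char_mod}, forall a s, g a s = gamma (s *: a).
Proof.
have gL a : linear (fun s : R^z => gamma ((s : R) *: a)).
  move=> n s t; rewrite -linearP; congr (gamma _).
  by rewrite !scalezrE scalerDl scalerMzl.
have [|g gE] := @pack_linear R A char_mod (fun a => HomMod (gL a)).
  move=> r a b; apply: hom_ext => s /=.
  by rewrite scalerDr scalerA linearD.
by exists g => a s; rewrite gE.
Qed.

Lemma char_mod_injective : injective_module char_mod.
Proof.
move=> A B i f ii.
have [||gamma gammaP] := injective_extend (A := B^z)
    (G := fun b q => exists a, i a = b /\ f a 1 = q) QZ_injective.
- split; first by exists 0; rewrite !linear0.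
  move=> n _ _ _ _ [a [<- <-]] [a' [<- <-]]; exists (a *~ n + a').
  rewrite !raddfD !raddfMz; split=> //.
  rewrite -[RHS]/((n *: (f a : hom_mod R^z QZ) + f a') 1).
  by rewrite -[in RHS](intz n) scaler_int.
- by move=> q [a [/(linear_inj0 ii)-> <-]]; rewrite linear0.
have [g gE] := char_coinduction gamma.
exists g => a; apply: hom_ext => s; rewrite gE; apply: gammaP.
by exists (s *: a); rewrite !linearZ /= mul1r.
Qed.

Arguments char_mod_injective {A B i} f.

Lemma char_mod_cogenerator (A : lmodType R) (x : A) :
  x <> 0 -> exists f : {linear A -> char_mod}, f x <> 0.
Proof.
move=> /QZ_cogenerator[gamma gx]; have [g gE] := char_coinduction gamma.
by exists g => gx0; apply: gx; rewrite -[x]scale1r -gE gx0.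
Qed.

End CharacterModule.

(** * Duality *)
Section Duality.
Variable R : comNzRingType.
Implicit Types A B C D F J K L M N P Q U V W X Y Z : lmodType R.

Local Notation E := (char_mod R).

Definition dual A : lmodType R := hom_mod A E.

Lemma hom_curry A B (b : A -> B -> E) :
    (forall r x y z, b (r *: x + y) z = r *: b x z + b y z) ->
    (forall r x y z, b z (r *: x + y) = r *: b z x + b z y) ->
  exists f : {linear A -> dual B}, forall x y, f x y = b x y.
Proof.
move=> bl br.
have bL x : linear (b x) by move=> r y z; apply: br.
have [|f fE] := @pack_linear R A (dual B) (fun x => HomMod (bL x)).
  by move=> r x y; apply: hom_ext => z; apply: bl.
by exists f => x y; rewrite fE.
Qed.

(** Maps from [A] to [dual B] and from [B] to [dual A] both are bilinear maps on
    [A] and [B]. *)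
Lemma hom_flip A B (f : {linear A -> dual B}) :
  exists g : {linear B -> dual A}, forall y x, g y x = f x y.
Proof.
by apply: (@hom_curry B A (fun y x => f x y)) => r x y z; rewrite linearP.
Qed.

Lemma dual_map A B (f : {linear A -> B}) :
  exists g : {linear dual B -> dual A}, forall xi a, g xi a = xi (f a).
Proof.
by apply: (@hom_curry (dual B) A (fun xi a => xi (f a))) => r x y z //;
   rewrite !linearP.
Qed.

Lemma eval_map A :
  exists e : {linear A -> dual (dual A)}, forall a xi, e a xi = xi a.
Proof.
by apply: (@hom_curry A (dual A) (fun a xi => xi a)) => r x y z //;
   rewrite linearP.
Qed.

Lemma dual_ses A B C (f : {linear A -> B}) (g : {linear B -> C})
    (f' : {linear dual B -> dual A}) (g' : {linear dual C -> dual B}) :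
    ses f g -> (forall xi a, f' xi a = xi (f a)) ->
    (forall xi a, g' xi a = xi (g a)) ->
  ses g' f'.
Proof.
move=> fg f'E g'E; have [fi gs e] := fg; split.
- apply: linear_inj => xi g'0; apply: hom_ext => c; have [b <-] := gs c.
  by rewrite -g'E g'0.
- move=> xi; have [h hE] := char_mod_injective (xi : {linear A -> E}) fi.
  by exists (hom_of h : dual B); apply: hom_ext => a; rewrite f'E; apply: hE.
- move=> xi; split=> [f'0|[eta <-]]; last first.
    by apply: hom_ext => a; rewrite f'E g'E (ses_comp0 _ e) linear0.
  have [a|h hE] := ses_factor_epi (h := (xi : {linear B -> E})) fg.
    by have := f'E xi a; rewrite f'0.
  by exists (hom_of h : dual C); apply: hom_ext => b; rewrite g'E; apply: hE.
Qed.

Lemma dual_short_exact A B C :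
  short_exact A B C -> short_exact (dual C) (dual B) (dual A).
Proof.
move=> [f [g fg]]; have [f' f'E] := dual_map f; have [g' g'E] := dual_map g.
by exists g', f'; apply: dual_ses fg f'E g'E.
Qed.

End Duality.

(** * Flat modules *)
Section Flat.
Variable R : comNzRingType.
Local Notation E := (char_mod R).
Implicit Types A B C D F J K L M N P Q U V W X Y Z : lmodType R.

Lemma tensor_uncurry P B (h : {linear B -> dual P}) :
  exists phi : {linear tensor P B -> E}, forall p b, phi (tens p b) = h b p.
Proof.
have bil : bilinear_for *:%R *:%R (fun (p : P) (b : B) => h b p : E).
  by split=> [b r x y|p r x y] /=; rewrite linearP.
pose b_fun (p : P) (b : B) : E := h b p.
pose beta : {bilinear P -> B -> E} := HB.pack b_fun
  (bilinear_isBilinear.Build R P B E _ _ b_fun bil).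
by exists (tensor_lift beta) => p b; rewrite tensor_liftE.
Qed.

Lemma tensor_curry P B (phi : {linear tensor P B -> E}) :
  exists h : {linear B -> dual P}, forall b p, h b p = phi (tens p b).
Proof.
apply: (@hom_curry R B P (fun b p => phi (tens p b))) => r x y z.
  by rewrite linearPr linearP.
by rewrite linearPl linearP.
Qed.

(** A map from [tensor P B] to the injective cogenerator is a map from [B] to
    [dual P].  Injectivity of the cogenerator extends functionals from the
    image of [tensor P B] to [tensor P C]; its cogeneration separates an
    element from the image of [tensor P A]. *)
Lemma tensor_exact_dual P A B C (f : {linear A -> B}) (g : {linear B -> C}) :
    (forall a, g (f a) = 0) ->
  exact_at (tensor_map P f) (tensor_map P g) <->
  forall h : {linear B -> dual P}, (forall a, h (f a) = 0) ->
    exists k : {linear C -> dual P}, forall b, k (g b) = h b.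
Proof.
move=> gf; split=> [e h hf|ext y].
  have [phi phiE] := tensor_uncurry h.
  have phif z : phi (tensor_map P f z) = 0.
    apply: (tensor_lin_ext (f := phi \o tensor_map P f) (g := \0)) => p a /=.
    by rewrite tensor_mapE phiE hf.
  have [||psi psiE] := injective_extend (A := tensor P C)
    (G := fun t e => exists s, tensor_map P g s = t /\ phi s = e)
    (@char_mod_injective R).
  - split; first by exists 0; rewrite !linear0.
    move=> r _ _ _ _ [s [<- <-]] [s' [<- <-]].
    by exists (r *: s + s'); rewrite !linearP.
  - by move=> _ [s [/e[z <-] <-]].
  have [k kE] := tensor_curry psi.
  exists k => b; apply: hom_ext => p; rewrite kE -phiE; apply: psiE.
  by exists (tens p b); rewrite tensor_mapE.
split=> [gy0|[x <-]]; last first.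
  apply: (tensor_lin_ext (f := tensor_map P g \o tensor_map P f) (g := \0)).
  by move=> p a /=; rewrite !tensor_mapE gf linear0r.
apply: contrapT => ny.
have [chi chiy] : exists chi : {linear coker (tensor_map P f) -> E},
    chi (quot_proj (im (tensor_map P f)) y) <> 0.
  by apply: char_mod_cogenerator => /coker_exact.
have [h hE] := tensor_curry (chi \o quot_proj (im (tensor_map P f))).
have [a|k kE] := ext h.
  apply: hom_ext => p; rewrite hE /= -tensor_mapE.
  have /coker_exact -> : exists x, tensor_map P f x = tensor_map P f (tens p a).
    by exists (tens p a).
  exact: linear0.
have [psi psiE] := tensor_uncurry k.
apply: chiy; rewrite -(linear0 psi) -gy0.
apply: (tensor_lin_ext (f := chi \o quot_proj (im (tensor_map P f)))
  (g := psi \o tensor_map P g)) => p b /=.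
by rewrite tensor_mapE psiE kE hE.
Qed.

(** Lambek's criterion. *)
Lemma flat_dual P : flat P <-> injective_module (dual P).
Proof.
split=> [Pflat A B i f ii|Pinj A B C f g e].
  have ei : exact_at (\0 : {linear zero_mod R -> A}) i.
    move=> a; split=> [/(linear_inj0 ii)->|[z <-]]; last exact: linear0.
    by exists 0.
  have /tensor_exact_dual ext := Pflat _ _ _ _ _ ei.
  by apply: ext => z; rewrite linear0.
apply/tensor_exact_dual => [a|h hf]; first exact: (ses_comp0 _ e).
have [||k kE] := injective_extend
    (G := fun c xi => exists b, g b = c /\ h b = xi) Pinj.
- split; first by exists 0; rewrite !linear0.
  move=> r _ _ _ _ [s [<- <-]] [s' [<- <-]].
  by exists (r *: s + s'); rewrite !linearP.
- by move=> _ [b [/e[a <-] <-]].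
by exists k => b; apply: kE; exists b.
Qed.

(** To extend a map from [A] to [dual P] over [B], flip it and lift it along the
    epimorphism from [dual B] to [dual A]. *)
Lemma flat_projective P : projective P -> flat P.
Proof.
move=> Pp; apply/flat_dual => A B i f ii.
have [f' f'E] := hom_flip f; have [i' i'E] := dual_map i.
have [xi|g gE] := Pp _ _ i' f'.
  have [h hE] := char_mod_injective (xi : {linear A -> E}) ii.
  by exists (hom_of h : dual B); apply: hom_ext => a; rewrite i'E; apply: hE.
have [g' g'E] := hom_flip g.
exists g' => a; apply: hom_ext => p.
by rewrite g'E -i'E gE f'E.
Qed.

Lemma flat_ext A B C : short_exact A B C -> flat A -> flat C -> flat B.
Proof.
move=> /dual_short_exact s /flat_dual Ai /flat_dual Ci.
by apply/flat_dual; apply: injective_ext s Ci Ai.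
Qed.

Lemma flat_ker A B C : short_exact A B C -> flat B -> flat C -> flat A.
Proof.
move=> /dual_short_exact s /flat_dual Bi /flat_dual Ci.
by apply/flat_dual; apply: injective_coker s Ci Bi.
Qed.

Lemma flat_zero Z : is_zero Z -> flat Z.
Proof.
move=> Z0; apply/flat_dual => A B i f ii; exists \0 => x.
by apply: hom_ext => z; rewrite (Z0 z) !linear0.
Qed.

Lemma flat_prod A B : flat A -> flat B -> flat (A * B)%type.
Proof.
move=> Af Bf; apply: (flat_ext _ Af Bf).
have [i iE] : exists i : {linear A -> (A * B)%type}, forall x, i x = (x, 0).
  by apply: pack_linear => r x y; rewrite pairZD scaler0 addr0.
have [p pE] : exists p : {linear (A * B)%type -> B}, forall x, p x = x.2.
  by apply: pack_linear.
exists i, p; split=> [x y|b|[x y]]; rewrite ?iE; first by case.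
  by exists (0, b); rewrite pE.
by rewrite pE; split=> [/= ->|[z]]; [exists x|rewrite iE => -[]].
Qed.

(** The dual of a sequence ending at a flat [F] splits, because [dual F] is
    injective; composing the flipped map with a section extends it. *)
Lemma Ext1_dual F N : flat F -> Ext1_eq0 F (dual N).
Proof.
move=> /flat_dual Fi X Y i p ip f.
have [i' i'E] := dual_map i; have [p' p'E] := dual_map p.
have s := dual_ses ip i'E p'E.
have [r rE] := injective_ses_split s Fi; have [t [tE _]] := split_section s rE.
have [f' f'E] := hom_flip f; have [g gE] := hom_flip (t \o f').
by exists g => x; apply: hom_ext => n; rewrite gE /= -i'E tE f'E.
Qed.

Lemma eval_inj A (e : {linear A -> dual (dual A)}) :
  (forall a xi, e a xi = xi a) -> injective e.
Proof.
move=> eE; apply: linear_inj => a ea0; apply: contrapT.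
move=> /char_mod_cogenerator[f]; apply.
by rewrite -[f a]/(hom_of f a) -eE ea0.
Qed.

Hypothesis R_noeth : noetherian R.

(** It suffices to apply Baer's criterion to [dual (dual J)].  Let [a] generate
    the domain of a partial map and let [b] be its values at [a].  An element of
    [dual (dual J)] inducing that map must send the sum of [a i *: xi i] to the
    sum of [b i (xi i)], so the point is that the latter vanishes whenever the
    former does ([key]).

    Let [r] generate the relations between the [a i].  A tuple [y] of elements
    of [J] satisfying the relations [r] defines a map on the ideal, hence is of
    the form [a i *: x] since [J] is injective, and then the sum of the
    [xi i (y i)] is zero.  So the functional [xi] on tuples factors through the
    map that evaluates the relations [r], and by injectivity of the cogenerator
    [xi i] is the sum of the [r j i *: eta j] for some [eta]; the claim follows
    because the [b i] satisfy the relations [r]. *)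
Lemma dual_flat J : injective_module J -> flat (dual J).
Proof.
move=> Jinj; apply/flat_dual/baer => G Glin Gsv.
have Icl : submod_closed [pred c : R^o | `[< exists b, G c b >]].
  split=> [|r c c' /asboolP[b Gb] /asboolP[b' Gb']]; apply/asboolP.
    by exists 0; case: Glin.
  by exists (r *: b + b'); case: Glin => _; apply.
have [n [a aP]] := R_noeth (Submodule Icl).
have G_sum (c : 'I_n -> R) (x : 'I_n -> R) (y : 'I_n -> dual (dual J)) :
    (forall i, G (x i) (y i)) -> G (\sum_i c i * x i) (\sum_i c i *: y i).
  move=> Gxy; elim/big_rec2: _ => [|i u v _ Guv]; first by case: Glin.
  by case: Glin => _; apply.
have /choice[b bP] (i : 'I_n) : exists y, G (a i) y.
  have /aP/asboolP// : exists c : 'I_n -> R, a i = \sum_j c j * a j.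
    exists (fun j => (j == i)%:R).
    rewrite (bigD1 i) //= eqxx mul1r big1 ?addr0 //.
    by move=> j /negPf->; rewrite mul0r.
have key (xi : 'I_n -> dual J) :
    \sum_i a i *: xi i = 0 -> \sum_i b i (xi i) = 0.
  move=> xi0.
  pose S (s : nat -> R) := (forall k, (n <= k)%N -> s k = 0) /\
    \sum_(i < n) s i * a i = 0.
  have [||I [r [Sr rP]]] := noetherian_submod_fg (n := n) (S := S) R_noeth.
  - split=> [w w0|c u v w [Su un] [Sv vn] wE].
      by split=> [k _|]; rewrite ?w0 // big1 // => i _; rewrite w0 mul0r.
    split=> [k nk|]; first by rewrite wE Su // Sv // mulr0 addr0.
    under eq_bigr => i _ do rewrite wE mulrDl -mulrA.
    by rewrite big_split /= -mulr_sumr un vn mulr0 addr0.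
  - by move=> s [].
  (* [H] is the partial functional on families indexed by the relations
     through which [xi] factors *)
  pose H (w : {ffun I -> J}) (e : E) := exists y : 'I_n -> J,
    (forall j, w j = \sum_(i < n) r j i *: y i) /\ e = \sum_i xi i (y i).
  have [||g gP] := injective_extend (G := H) (@char_mod_injective R).
  - split.
      exists (fun _ => 0); split=> [j|].
        by rewrite ffunE big1 // => i _; rewrite scaler0.
      by rewrite big1 // => i _; rewrite linear0.
    move=> t w e w' e' [y [wE ->]] [y' [w'E ->]].
    exists (fun i => t *: y i + y' i); split=> [j|].
      rewrite !ffunE wE w'E scaler_sumr -big_split; apply: eq_bigr => i _ /=.
      by rewrite scalerDr !scalerA mulrC.
    rewrite scaler_sumr -big_split; apply: eq_bigr => i _ /=.
    by rewrite linearP.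
  - move=> e [y [yr ->]].
    have yS s : S s -> \sum_(i < n) s i *: y i = 0.
      apply: (rP (fun s => \sum_(i < n) s i *: y i = 0)) => [|j].
        split=> [w w0|c u v w u0 v0 wE].
          by rewrite big1 // => i _; rewrite w0 scale0r.
        under eq_bigr => i _ do rewrite wE scalerDl -scalerA.
        by rewrite big_split /= -scaler_sumr u0 v0 scaler0 addr0.
      by rewrite -yr ffunE.
    (* the map from the ideal to [J] that sends [a i] to [y i] *)
    have [||h hP] := injective_extend (A := R^o)
       (G := fun c z => exists s : nat -> R,
          (forall k, (n <= k)%N -> s k = 0) /\
          c = \sum_(i < n) s i * a i /\ z = \sum_(i < n) s i *: y i) Jinj.
    + split.
        exists (fun _ => 0); split=> //; split; rewrite big1 // => i _.
          by rewrite mul0r.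
        by rewrite scale0r.
      move=> t _ _ _ _ [s [s0 [-> ->]]] [s' [s'0 [-> ->]]].
      exists (fun k => t * s k + s' k); split=> [k nk|].
        by rewrite s0 // s'0 // mulr0 addr0.
      split; rewrite scaler_sumr -big_split; apply: eq_bigr => i _ /=.
        by rewrite mulrDl -mulrA.
      by rewrite scalerDl scalerA.
    + by move=> z [s [s0 [s1 ->]]]; apply: yS; split.
    have yh i : y i = a i *: h 1.
      rewrite -linearZ /=; apply/esym/hP.
      exists (fun k => (k == i :> nat)%:R); split=> [k nk|].
        by case: eqP => // ki; move: nk; rewrite ki leqNgt ltn_ord.
      split; rewrite (bigD1 i) //= eqxx ?mul1r ?scale1r big1 ?addr0 //.
      - exact: mulr1.
      - by move=> j /negPf; rewrite -val_eqE /= => ->; rewrite mul0r.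
      - by move=> j /negPf; rewrite -val_eqE /= => ->; rewrite scale0r.
    transitivity ((\sum_i a i *: xi i) (h 1)); last by rewrite xi0.
    elim/big_rec2: _ => // i u v _ uv.
    by rewrite homD homZ -uv yh linearZ.
  (* restrictions of the functional to the summands of the power of [J] *)
  have /choice[eta etaE] (j : I) : exists f : dual J, forall y,
      f y = g [ffun k => if k == j then y else 0].
    have [|f fE] := @pack_linear R J E
      (fun y => g [ffun k => if k == j then y else 0]).
      move=> t x y; rewrite -linearP; congr (g _); apply/ffunP => k.
      by rewrite !ffunE; case: eqP => // _; rewrite scaler0 addr0.
    by exists (hom_of f) => y; rewrite -fE.
  have xiE i : xi i = \sum_j r j i *: eta j.
    apply: hom_ext => y.
    transitivity (g [ffun j => r j i *: y]).
      apply/esym/gP; exists (fun k => if k == i then y else 0); split=> [j|].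
        rewrite ffunE (bigD1 i) //= eqxx big1 ?addr0 // => k /negPf->.
        by rewrite scaler0.
      rewrite (bigD1 i) //= eqxx big1 ?addr0 // => k /negPf->.
      by rewrite linear0.
    transitivity (\sum_j r j i *: eta j y); last first.
      by elim/big_rec2: _ => // j u v _ uv; rewrite homD homZ uv.
    under eq_bigr => j _ do rewrite -linearZ /= etaE.
    rewrite -linear_sum; congr (g _); apply/ffunP => j.
    rewrite sum_ffunE ffunE (bigD1 j) //= ffunE eqxx big1 ?addr0 // => k.
    by rewrite ffunE eq_sym => /negPf->.
  under eq_bigr => i _ do rewrite xiE linear_sum.
  rewrite exchange_big big1 //= => j _.
  transitivity ((\sum_(i < n) r j i *: b i) (eta j)).
    by elim/big_rec2: _ => // i u v _ uv; rewrite homD homZ uv linearZ.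
  have -> : \sum_(i < n) r j i *: b i = 0; last by [].
  by apply: Gsv; case: (Sr j) => _ <-; apply: G_sum.
pose Z (zeta : dual J) (e : E) := exists xi : 'I_n -> dual J,
  zeta = \sum_i a i *: xi i /\ e = \sum_i b i (xi i).
have [||z zP] := injective_extend (G := Z) (@char_mod_injective R).
- split.
    exists (fun _ => 0); split; rewrite big1 // => i _; first exact: scaler0.
    exact: linear0.
  move=> t _ _ _ _ [xi [-> ->]] [xi' [-> ->]].
  exists (fun i => t *: xi i + xi' i); split.
    rewrite scaler_sumr -big_split; apply: eq_bigr => i _ /=.
    by rewrite scalerDr !scalerA mulrC.
  rewrite scaler_sumr -big_split; apply: eq_bigr => i _ /=.
  by rewrite linearP.
- by move=> e [xi [/esym/key xi0 ->]].
exists (hom_of z : dual (dual J)) => c y Gcy.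
have /aP[d cE] : c \in submod_pred (Submodule Icl) by apply/asboolP; exists y.
have -> : y = \sum_i d i *: b i.
  by apply: (single_valued_eq Glin Gsv Gcy); rewrite cE; apply: G_sum.
apply: hom_ext => xi; rewrite homZ /= -linearZ.
transitivity (\sum_i b i (d i *: xi)).
  elim/big_rec2: _ => // i u v _ uv.
  by rewrite homD homZ uv linearZ.
apply/esym/zP; exists (fun i => d i *: xi); split=> //.
rewrite cE scaler_suml; apply: eq_bigr => i _.
by rewrite scalerA mulrC.
Qed.

Lemma flat_double_dual F : flat F -> flat (dual (dual F)).
Proof. by move=> /flat_dual; apply: dual_flat. Qed.

(** Evaluation from [F] to its double dual is split after dualizing, so the dual
    of the cokernel is a direct summand of the dual of [dual (dual F)], which is
    injective. *)
Lemma flat_pure_embedding F : flat F ->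
  exists2 Q, short_exact F (dual (dual F)) Q & flat Q.
Proof.
move=> Fflat; have [e eE] := eval_map F.
have s := ses_coker (eval_inj eE).
exists (coker e); first by exists e, (quot_proj (im e)).
set q : {linear dual (dual F) -> coker e} := quot_proj _ in s.
have [e' e'E] := dual_map e; have [q' q'E] := dual_map q.
have s' := dual_ses s e'E q'E.
have [d dE] := eval_map (dual F).
have [|r rE] := split_retraction (s := d) s'.
  by move=> xi; apply: hom_ext => x; rewrite e'E dE eE.
apply/flat_dual; apply: injective_retract rE _.
by apply/flat_dual/flat_double_dual.
Qed.

End Flat.

(** * Gorenstein flat modules *)
Lemma linear_bijective (R : comNzRingType) (A B : lmodType R)
    (f : {linear A -> B}) :
  injective f -> (forall b, exists a, f a = b) -> bijective f.
Proof. by move=> fi /choice[g gK]; exists g => // a; apply: fi. Qed.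

Section GorensteinFlat.
Variable R : comNzRingType.
Implicit Types A B C D F J K L M N P Q U V W X Y Z : lmodType R.

(** Since Ext^1(X, dual J) is the dual of Tor_1(X, J), this says that
    Tor_1(X, J) = 0 for every injective [J]. *)
Definition injective_tor1_eq0 X : Prop :=
  forall J, injective_module J -> Ext1_eq0 X (dual J).

Definition gf_closed (C : lmodType R -> Prop) : Prop :=
  forall X, C X ->
    [/\ injective_tor1_eq0 X,
        exists F X', [/\ flat F, C X' & short_exact X F X'] &
        exists P X1, [/\ flat P, C X1 & short_exact X1 P X]].

(** Iterating the two sequences that define [gf_closed] yields complete flat
    resolutions, so this is Gorenstein flatness ([gorenstein_flatE]); the
    union of all closed classes is the form suited to coinduction. *)
Definition GF X : Prop := exists2 C, gf_closed C & C X.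

Lemma GF_closed : gf_closed GF.
Proof.
move=> X [C Ccl CX].
have [TX [F [X' [Ff CX' s]]] [P [X1 [Pf CX1 s1]]]] := Ccl X CX.
by split=> //; [exists F, X'|exists P, X1]; split=> //; exists C.
Qed.

Lemma GF_coind (C : lmodType R -> Prop) :
    (forall X, C X ->
      [/\ injective_tor1_eq0 X,
          exists F X', [/\ flat F, C X' \/ GF X' & short_exact X F X'] &
          exists P X1, [/\ flat P, C X1 \/ GF X1 & short_exact X1 P X]]) ->
  forall X, C X -> GF X.
Proof.
move=> CP X CX; exists (fun Y => C Y \/ GF Y); last by left.
move=> Y [/CP//|/GF_closed[TY [F [X' [Ff CX' s]]] [P [X1 [Pf CX1 s1]]]]].
by split=> //; [exists F, X'|exists P, X1]; split=> //; right.
Qed.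

(** The syzygies of a complete flat resolution.  They are produced as a bare
    sequence of modules first, so that the terms and maps of the resolution can
    be chosen afterwards with indices [i + 1] and [i] and without any cast. *)
Lemma GF_int_sequence X : GF X ->
  exists s : int -> lmodType R, [/\ s 0 = X, forall i, GF (s i) &
    forall i, exists2 F, flat F & short_exact (s (i + 1)) F (s i)].
Proof.
move=> GX.
have /choice[l lP] Y : exists Y1, GF Y ->
    GF Y1 /\ exists2 F, flat F & short_exact Y1 F Y.
  have [GY|nG] := pselect (GF Y); last by exists Y.
  have [_ _ [P [Y1 [Pf GY1 s]]]] := GF_closed GY.
  by exists Y1 => _; split=> //; exists P.
have /choice[r rP] Y : exists Y', GF Y ->
    GF Y' /\ exists2 F, flat F & short_exact Y F Y'.
  have [GY|nG] := pselect (GF Y); last by exists Y.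
  have [_ [F [Y' [Ff GY' s]]] _] := GF_closed GY.
  by exists Y' => _; split=> //; exists F.
have Gl n : GF (iter n l X) by elim: n => //= n /lP[].
have Gr n : GF (iter n r X) by elim: n => //= n /rP[].
exists (fun i =>
  match i with Posz n => iter n l X | Negz n => iter n.+1 r X end).
have succP (n : nat) : Posz n + 1 = Posz n.+1 by rewrite -addn1 PoszD.
have succN (n : nat) : Negz n.+1 + 1 = Negz n.
  by rewrite !NegzE -addn1 PoszD opprD subrK.
split=> // [[n|n]|[n|[|n]]]; rewrite ?succP ?succN.
- exact: Gl.
- exact: Gr.
- by have [] := lP _ (Gl n).
- by have [] := rP _ GX.
- by have [] := rP _ (Gr n.+1).
Qed.

(** Splice the sequences between consecutive syzygies.  A cocycle with values in
    [dual J] factors through a syzygy and extends by the vanishing of Ext^1, so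
    the complex stays exact after tensoring with [J]. *)
Lemma GF_gorenstein_flat X : GF X -> gorenstein_flat X.
Proof.
move=> /GF_int_sequence[s [<- sG sF]] {X}.
have /choice[F FP] i : exists F, flat F /\ short_exact (s (i + 1)) F (s i).
  by have [F] := sF i; exists F.
pose f i := projT1 (cid (proj2 (FP i))).
pose g i := projT1 (cid (projT2 (cid (proj2 (FP i))))).
have fg i : ses (f i) (g i) := projT2 (cid (projT2 (cid (proj2 (FP i))))).
have fi i : injective (f i) by have [] := fg i.
have gs i : forall c, exists b, g i b = c by have [] := fg i.
have e i : exact_at (f i) (g i) by have [] := fg i.
pose d i : {linear F (i + 1) -> F i} := f i \o g (i + 1).
have dK i x : d i (d (i + 1) x) = 0 by rewrite /= (ses_comp0 _ (e _)) linear0.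
pose FC := IntComplex dK.
have d_ker i y : d i y = 0 <-> g (i + 1) y = 0.
  by split=> [/(linear_inj0 (@fi i))|/= ->]; rewrite ?linear0.
have d_im i y : (exists x, d i x = y) <-> exists z, f i z = y.
  split=> [[x <-]|[z <-]]; first by exists (g (i + 1) x).
  by have [x <-] := gs _ z; exists x.
exists FC.
  split=> [i|i y|J Jinj i]; first by case: (FP i).
    by rewrite d_im d_ker e.
  apply/tensor_exact_dual => [x|h hd]; first exact: dK.
  have [x|k kE] := ses_factor_epi (h := h) (fg (i + 1)).
    by have [y <-] := gs _ x; apply: hd.
  have [TX _ _] := GF_closed (sG i).
  have [k' k'E] := TX _ Jinj _ _ _ _ (fg i) k.
  by exists k' => b; rewrite -kE -k'E.
exists 0.
have [|h hE] := factor_epi (h := g 0) (@quot_proj_surj _ _ (im (d 0))).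
  by move=> y /coker_exact/d_im/e.
exists h; apply: linear_bijective => [|c].
  apply: linear_inj => z; have [y <-] := quot_proj_surj z.
  by rewrite [h _]hE => /e/d_im/coker_exact.
by have [y <-] := gs _ c; exists (quot_proj _ y); rewrite [h _]hE.
Qed.

(** The class of all cokernels of differentials of the given complete flat
    resolution is closed. *)
Lemma gorenstein_flat_GF X : gorenstein_flat X -> GF X.
Proof.
move=> [FC Fcompl [i0 [h0 h0bij]]].
pose C Y := exists i (g : {linear FC i -> Y}),
  (forall y, exists x, g x = y) /\ exact_at (zdiff FC i) g.
exists C; last first.
  exists i0, (h0 \o (quot_proj (im (zdiff FC i0)) : {linear _ -> coker _})).
  have [h1 h0K h1K] := h0bij; split=> [y|x].
    by have [x xE] := quot_proj_surj (h1 y); exists x; rewrite /= xE h1K.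
  rewrite -(coker_exact (zdiff FC i0) x) /=; split=> [|->]; last exact: linear0.
  exact: (linear_inj0 (can_inj h0K)).
move=> {X i0 h0 h0bij} Y [i [g [gs e]]].
have [Fflat Fexact Ftensor] := Fcompl.
have [X1 [x1 s1]] := ex_ses_ker gs.
have [x1i _ xe] := s1.
have [|p pE] := factor_mono (h := zdiff FC i) x1i.
  by move=> z; apply/xe; apply: (ses_comp0 _ e).
have ps z : exists w, p w = z.
  have /e[w wE] : g (x1 z) = 0 by apply: (ses_comp0 _ xe).
  by exists w; apply: x1i; rewrite pE.
have pe : exact_at (zdiff FC (i + 1)) p.
  move=> w; rewrite -(Fexact i w) -pE; split=> [->|]; first exact: linear0.
  exact: (linear_inj0 x1i).
split.
- move=> J Jinj; apply: (Ext1_criterion s1 (Ext1_dual (Fflat i))) => f.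
  have /tensor_exact_dual ext := Ftensor J Jinj i.
  have [a|w|k kE] := ext _ (f \o p).
  + exact: zdiffK.
  + by rewrite /= (ses_comp0 _ pe) linear0.
  + exists k => z; have [w <-] := ps z.
    by rewrite pE kE.
- have [j ij] : exists j, i = j + 1 by exists (i - 1); rewrite subrK.
  move: g gs e {s1 p pE ps pe x1 x1i xe}; rewrite {}ij {i} => g gs e.
  have [|k kE] := factor_epi (h := zdiff FC j) gs.
    by move=> z /e/Fexact.
  exists (FC j), (coker (zdiff FC j)); split=> //.
    exists j, (quot_proj (im (zdiff FC j)) : {linear _ -> coker _}).
    by split; [exact: quot_proj_surj|exact: coker_exact].
  exists k, (quot_proj (im (zdiff FC j)) : {linear _ -> coker _}); split.
  + apply: linear_inj => y; have [z <-] := gs y.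
    by rewrite kE => /Fexact/e.
  + exact: quot_proj_surj.
  + move=> z; rewrite (coker_exact (zdiff FC j) z); split=> -[w <-].
      by exists (g w); rewrite kE.
    by have [v <-] := gs w; exists v; rewrite kE.
- exists (FC i), X1; split=> //; last by exists x1, g.
  by exists (i + 1), p.
Qed.

Lemma injective_tor1_ext A B C : short_exact A B C ->
  injective_tor1_eq0 A -> injective_tor1_eq0 C -> injective_tor1_eq0 B.
Proof.
by move=> [f [g fg]] TA TC J Ji; apply: Ext1_extl fg (TA J Ji) (TC J Ji).
Qed.

Lemma injective_tor1_flat F : flat F -> injective_tor1_eq0 F.
Proof. by move=> Ff J _; apply: Ext1_dual. Qed.

Lemma GF_flat F : flat F -> GF F.
Proof.
apply: GF_coind => {}F Ff; split; first exact: injective_tor1_flat.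
  exists F, (zero_mod R); split=> //; last exact: short_exact_id0.
  by left; apply: flat_zero _ (@zero_modP R).
exists F, (zero_mod R); split=> //; last exact: short_exact_0id.
by left; apply: flat_zero _ (@zero_modP R).
Qed.

(** Pushing the sequence out along an embedding of [A] in a flat module embeds
    [B] in a flat module with the same cokernel. *)
Lemma GF_ext_flat A B Q : short_exact A B Q -> GF A -> flat Q -> GF B.
Proof.
move=> s GA Qf; suff : exists A Q, [/\ short_exact A B Q, GF A & flat Q].
  apply: (@GF_coind (fun B => exists A Q,
    [/\ short_exact A B Q, GF A & flat Q])).
  move=> {s GA Qf A Q}{}B [A [Q [s GA Qf]]].
  have [TA [F [A' [Ff GA' sF]]] [P [A1 [Pf GA1 sP]]]] := GF_closed GA.
  split; first exact: injective_tor1_ext s TA (injective_tor1_flat Qf).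
    have [D s1 s2] := pushout s sF.
    exists D, A'; split=> //; last by right.
    exact: flat_ext _ _ _ s1 Ff Qf.
  have [Q1 [P' [i [p [ip P'p]]]]] := ex_projective_cover Q.
  have sQ : short_exact Q1 P' Q by exists i, p.
  have P'f := flat_projective P'p.
  have [B1 s1 s2] := horseshoe P'p s sP sQ.
  exists (P * P')%type, B1; split=> //; first exact: flat_prod _ _ Pf P'f.
  left; exists A1, Q1; split=> //.
  exact: flat_ker _ _ _ sQ P'f Qf.
by exists A, Q.
Qed.

(** Let [W] be the pullback of [P] and of a flat cover of [C] with Gorenstein
    flat kernel.  It is an extension of the flat [P] by a Gorenstein flat module
    and it contains [A] with flat cokernel.  Hence the inverse image [V] of [A]
    in a flat cover of [W] is flat, which gives both the flat cover of [A] and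
    the Ext^1 condition. *)
Lemma GF_kernel A P C : short_exact A P C -> flat P -> GF C -> GF A.
Proof.
move=> s Pf GC; suff : exists P C, [/\ short_exact A P C, flat P & GF C].
  apply: (@GF_coind (fun A => exists P C,
    [/\ short_exact A P C, flat P & GF C])).
  move=> {s Pf GC P C}{}A [P [C [s Pf GC]]].
  have [_ _ [P' [C' [P'f GC' s']]]] := GF_closed GC.
  have [W s1 [m [q mq]]] := pullback s s'.
  have GW := GF_ext_flat s1 GC' Pf.
  have [TW _ [PW [W1 [PWf GW1 [l [p lp]]]]]] := GF_closed GW.
  have [V [x [y [z [sV sA xy _]]]]] := preimage_maps lp mq.
  have Vf : flat V.
    by apply: (flat_ker _ PWf P'f); exists x, (q \o p).
  split.
  - move=> J Ji; apply: (Ext1_criterion sA (Ext1_dual Vf)) => f.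
    have [k kE] := TW J Ji _ _ _ _ lp f.
    by exists (k \o x) => t /=; rewrite xy kE.
  - by exists P, C; split=> //; right.
  - by exists V, W1; split=> //; [right|exists y, z].
by exists P, C.
Qed.

Hypothesis R_noeth : noetherian R.

(** Enlarging the flat module to a dual makes it possible to extend the
    embedding of [A] over an extension of [A] by a Gorenstein flat module. *)
Lemma GF_double_dual_embedding A : GF A ->
  exists N A', [/\ flat (dual (dual N)), injective_module (dual N), GF A' &
    short_exact A (dual (dual N)) A'].
Proof.
move=> /GF_closed[_ [F [A' [Ff GA' s]]] _].
have [Q sQ Qf] := flat_pure_embedding R_noeth Ff.
have [A'' s1 s2] := compose_mono s sQ.
exists F, A''; split=> //.
- exact: flat_double_dual R_noeth _ Ff.
- exact/flat_dual.
- exact: GF_ext_flat s2 GA' Qf.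
Qed.

(** Both sides are horseshoe constructions.  On the right, Ext^1 of a Gorenstein
    flat module into the dual of an injective module vanishes; on the left, [C]
    is covered by a projective module, whose kernel is Gorenstein flat by
    [GF_kernel]. *)
Lemma GF_ext A B C : short_exact A B C -> GF A -> GF C -> GF B.
Proof.
move=> s GA GC; suff : exists A C, [/\ short_exact A B C, GF A & GF C].
  apply: (@GF_coind (fun B => exists A C, [/\ short_exact A B C, GF A & GF C])).
  move=> {s GA GC A C}{}B [A [C [s GA GC]]].
  have [TA _ [P [A1 [Pf GA1 sP]]]] := GF_closed GA.
  have [TC [F' [C' [F'f GC' sF']]] _] := GF_closed GC.
  split; first exact: injective_tor1_ext s TA TC.
    have [N [A' [Ff Ni GA' [u [u' uu']]]]] := GF_double_dual_embedding GA.
    have [f [g fg]] := s; have [t tE] := TC _ Ni _ _ _ _ fg u.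
    have [B' s1 s2] := cohorseshoe fg uu' sF' tE.
    exists (dual (dual N) * F')%type, B'; split=> //.
      exact: flat_prod _ _ Ff F'f.
    by left; exists A', C'.
  have [C1 [Q [i [p [ip Qp]]]]] := ex_projective_cover C.
  have sQ : short_exact C1 Q C by exists i, p.
  have Qf := flat_projective Qp.
  have [B1 s1 s2] := horseshoe Qp s sP sQ.
  exists (P * Q)%type, B1; split=> //; first exact: flat_prod _ _ Pf Qf.
  by left; exists A1, C1; split=> //; apply: GF_kernel sQ Qf GC.
by exists A, C.
Qed.

End GorensteinFlat.

(** * Cotorsion modules *)
Section Cotorsion.
Variable R : comNzRingType.
Implicit Types A B C D F G J K L M N P Q U V W X Y Z : lmodType R.

Lemma flat_syzygies F (P : nat_complex R) j :
    flat F -> is_resolution (@projective R) F P ->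
  exists Z (g : {linear P j -> Z}),
    [/\ flat Z, forall z, exists x, g x = z & exact_at (ndiff P j) g].
Proof.
move=> Ff [Pproj [aug [augs e0 e]]].
elim: j => [|j [Z [g [Zf gs eg]]]]; first by exists F, aug.
have [X [i ig]] := ex_ses_ker gs; have [ii _ ei] := ig.
have [x|p pE] := ses_factor_mono (h := ndiff P j) ig.
  exact: (ses_comp0 _ eg).
exists X, p; split.
- apply: (@flat_ker _ X (P j) Z) => //; first by exists i, g.
  by apply: flat_projective; apply: Pproj.
- move=> z; have /eg[x xz] : g (i z) = 0 by apply: (ses_comp0 _ ei).
  by exists x; apply: ii; rewrite pE.
- move=> y; rewrite -(e j y) -pE; split=> [->|]; first exact: linear0.
  exact: (linear_inj0 ii).
Qed.

(** Syzygies of flat modules are flat, so the vanishing of the first Ext on all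
    flat modules gives that of the higher ones. *)
Lemma cotorsion_Ext1 K : cotorsion K <-> forall F, flat F -> Ext1_eq0 F K.
Proof.
split=> [Kcot F Ff|Kcot [//|j] F _ Ff P Pres g gd].
  have Pres := projective_resolution_exists F.
  have := Kcot 1%N F isT Ff _ Pres; set P := std_resolution F in Pres *.
  move: Pres => [Pproj [aug [augs e0 e]]] H.
  have [X [i ia]] := ex_ses_ker augs; have [ii _ ei] := ia.
  apply: (Ext1_criterion ia (Ext1_projective (Pproj 0%N))) => f.
  have [x|p pE] := ses_factor_mono (h := ndiff P 0) ia.
    exact: (ses_comp0 _ e0).
  have [x|h hE] := H (f \o p).
    have p0 : p (ndiff P 1 x) = 0.
      by apply: (linear_inj0 ii); rewrite pE; apply/(e 0%N); exists x.
    by rewrite [LHS](congr1 f p0) linear0.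
  exists h => x; have /e0[y yE] : aug (i x) = 0 by apply: (ses_comp0 _ ei).
  by rewrite -yE -hE /=; congr (f _); apply: ii; rewrite pE.
have [Z [q [Zf qs eq]]] := flat_syzygies j Ff Pres.
have [X [i iq]] := ex_ses_ker qs; have [ii _ ei] := iq.
have [x|p pE] := ses_factor_mono (h := ndiff P j) iq.
  exact: (ses_comp0 _ eq).
have ps z : exists x, p x = z.
  have /eq[x xz] : q (i z) = 0 by apply: (ses_comp0 _ ei).
  by exists x; apply: ii; rewrite pE.
have [x px0|k kE] := factor_epi (h := g) ps.
  have [_ [_ [_ _ e]]] := Pres.
  have /e[y <-] : ndiff P j x = 0 by rewrite -pE px0 linear0.
  exact: gd.
have [h hE] := Kcot Z Zf _ _ _ _ iq k.
by exists h => x; rewrite -kE -hE pE.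
Qed.

Lemma cotorsion_dual N : cotorsion (dual N).
Proof. by apply/cotorsion_Ext1 => F; apply: Ext1_dual. Qed.

Lemma cotorsion_ext A B C :
  short_exact A B C -> cotorsion A -> cotorsion C -> cotorsion B.
Proof.
move=> s /cotorsion_Ext1 Ac /cotorsion_Ext1 Cc; apply/cotorsion_Ext1 => F Ff.
exact: (Ext1_extr s (Ac F Ff) (Cc F Ff)).
Qed.

Lemma cotorsion_coker A B C :
  short_exact A B C -> cotorsion A -> cotorsion B -> cotorsion C.
Proof.
move=> s /cotorsion_Ext1 Ac /cotorsion_Ext1 Bc; apply/cotorsion_Ext1 => F Ff.
have [F1 [Q [i [p [ip Qp]]]]] := ex_projective_cover F.
have sQ : short_exact F1 Q F by exists i, p.
apply: (Ext1_coker sQ Qp s) (Bc F Ff); apply: Ac.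
exact: flat_ker sQ (flat_projective Qp) Ff.
Qed.

(** Existence of a resolution of length at most [n] by modules in [cls], cut
    into short exact sequences; see [resolution_dim_le]. *)
Fixpoint dim_le (cls : lmodType R -> Prop) n M : Prop :=
  if n is n'.+1 then
    exists K P, [/\ cls P, dim_le cls n' K & short_exact K P M]
  else cls M.

Lemma dim_le_sub (cls cls' : lmodType R -> Prop) n M :
  (forall X, cls X -> cls' X) -> dim_le cls n M -> dim_le cls' n M.
Proof.
move=> sub; elim: n M => [|n IHn] M; first exact: sub.
by move=> [K [P [cP /IHn dK s]]]; exists K, P; split=> //; apply: sub.
Qed.

Hypothesis R_noeth : noetherian R.

Definition cotorsion_embedding n Y : Prop :=
  exists K F,
    [/\ cotorsion K, dim_le (@flat R) n K, flat F & short_exact Y K F].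

(** Push a flat presentation of [Y] out along a cotorsion embedding of its
    kernel: the middle term becomes an extension of flat modules. *)
Lemma flat_precover_of_embedding n Y :
    (forall X, dim_le (@flat R) n X -> cotorsion_embedding n X) ->
    dim_le (@flat R) n.+1 Y ->
  exists K P,
    [/\ flat P, cotorsion K, dim_le (@flat R) n K & short_exact K P Y].
Proof.
move=> emb [K0 [P0 [P0f dK0 s0]]].
have [K [F [Kc dK Ff s1]]] := emb _ dK0.
have [P s2 s3] := pushout s0 s1.
by exists K, P; split=> //; apply: flat_ext s3 P0f Ff.
Qed.

(** For [n = 0] use the double dual.  Otherwise write [Y] as [P/K] with [P] flat
    and [K] cotorsion and replace [P] by its double dual: the quotient by [K] is
    cotorsion and contains [Y] with flat cokernel. *)
Lemma ex_cotorsion_embedding n Y :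
  dim_le (@flat R) n Y -> cotorsion_embedding n Y.
Proof.
elim: n Y => [|n IHn] Y dY.
  have [Q s Qf] := flat_pure_embedding R_noeth dY.
  exists (dual (dual Y)), Q; split=> //; first exact: cotorsion_dual.
  exact: flat_double_dual.
have [K [P [Pf Kc dK s]]] := flat_precover_of_embedding IHn dY.
have [F sF Ff] := flat_pure_embedding R_noeth Pf.
have [Y' s1 s2] := compose_mono s sF.
exists Y', F; split=> //.
  exact: cotorsion_coker s1 Kc (@cotorsion_dual _).
by exists K, (dual (dual P)); split=> //; apply: flat_double_dual.
Qed.

Lemma special_flat_precover n Y : dim_le (@flat R) n.+1 Y ->
  exists K P,
    [/\ flat P, cotorsion K, dim_le (@flat R) n K & short_exact K P Y].
Proof. exact/flat_precover_of_embedding/ex_cotorsion_embedding. Qed.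

(** A flat cotorsion [Y] is a direct summand of its double dual, since the
    cokernel of the evaluation map is flat. *)
Lemma Ext1_GF_flat_cotorsion G Y :
  GF G -> flat Y -> cotorsion Y -> Ext1_eq0 G Y.
Proof.
move=> /GF_closed[TG _ _] Yf /cotorsion_Ext1 Yc.
have [Q [i [q iq]] Qf] := flat_pure_embedding R_noeth Yf.
have [r rE] := Yc Q Qf _ _ _ _ iq idfun.
by apply: (Ext1_retract rE); apply: TG; apply/flat_dual.
Qed.

Lemma Ext1_GF_CF n G Y :
  GF G -> dim_le (@flat R) n Y -> cotorsion Y -> Ext1_eq0 G Y.
Proof.
elim: n G Y => [|n IHn] G Y GG; first exact: Ext1_GF_flat_cotorsion.
move=> /special_flat_precover[K [P [Pf Kc dK s]]] Yc.
have [G1 [Q [i [p [ip Qp]]]]] := ex_projective_cover G.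
have sQ : short_exact G1 Q G by exists i, p.
apply: (Ext1_coker sQ Qp s).
  by apply: IHn => //; apply: GF_kernel sQ (flat_projective Qp) GG.
by apply: Ext1_GF_flat_cotorsion => //; apply: cotorsion_ext s Kc Yc.
Qed.

(** If [M = G0/K0] and [K0] embeds in [KN], the pushout [X] is an extension of
    Gorenstein flat modules, hence embeds in a flat [F], and [M = X/KN] embeds
    in [F/KN]. *)
Lemma GF_embedding n M : dim_le (@GF R) n M ->
  exists K C, [/\ dim_le (@flat R) n K, GF C & short_exact M K C].
Proof.
elim: n M => [|n IHn] M.
  by move=> /GF_closed[_ [F [C [Ff GC s]]] _]; exists F, C.
move=> [K0 [G0 [GG0 /IHn[KN [C [dKN GC sN]]] s0]]].
have [X s1 s2] := pushout s0 sN.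
have /GF_closed[_ [F [C' [Ff GC' sX]]] _] := GF_ext R_noeth s2 GG0 GC.
have [K s3 s4] := compose_mono s1 sX.
by exists K, C'; split=> //; exists KN, F.
Qed.

(** The inverse image of [M] in a flat cover [P] of [K] is the kernel of a map
    from [P] onto [C], hence Gorenstein flat. *)
Lemma GF_dim_le_of_embedding m M K C :
  dim_le (@flat R) m K -> short_exact M K C -> GF C -> dim_le (@GF R) m M.
Proof.
case: m => [|m] dK s GC; first exact: GF_kernel s dK GC.
have [L [P [Pf dL sL]]] := dK.
have [X s1 s2] := preimage sL s.
exists L, X; split=> //; first exact: GF_kernel s1 Pf GC.
by apply: dim_le_sub dL; apply: GF_flat.
Qed.

End Cotorsion.

(** * Resolution dimensions *)
Section Dimension.
Variable R : comNzRingType.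
Implicit Types (A B K M X Z : lmodType R) (G : nat_complex R).
Local Open Scope classical_set_scope.

Lemma infimum_min (x0 : \bar int) (D : set (\bar int)) m :
  D m -> (forall x, D x -> (m <= x)%E) -> infimum x0 D = m.
Proof.
move=> Dm mD; rewrite /infimum.
case: ifPn => [/eqP D0|_]; first by rewrite D0 in Dm.
have mI : infimums D m by split=> // y; apply.
case: xgetP => [y _ yI|/(_ m)//].
exact: is_subset1_infimums yI mI.
Qed.

(** The trichotomy also establishes that the supremum exists; otherwise its
    value would be the default one. *)
Lemma complex_lengthP (G : nat_complex R) :
  [\/ complex_length G = -oo%E /\ forall i, is_zero (G i),
      exists n : nat, [/\ complex_length G = n%:Z%:E, ~ is_zero (G n)
        & forall i, (n < i)%N -> is_zero (G i)]
    | complex_length G = +oo%E /\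
        forall n : nat, exists2 i, (n < i)%N & ~ is_zero (G i)].
Proof.
rewrite /complex_length; set S := [set l | _].
have supE y : supremums S y -> S !=set0 -> supremum -oo%E S = y.
  move=> yS /set0P S0; rewrite /supremum (negPf S0).
  by case: xgetP => [z _ zS|/(_ y)//]; apply: is_subset1_supremums zS yS.
have [Gz|/existsNP[i0 Gi0]] := pselect (forall i, is_zero (G i)).
  apply: Or31; split=> //; have -> : S = set0; last exact: supremum0.
  by apply/seteqP; split=> // l [n nz _]; apply: nz.
have S0 : S !=set0 by exists i0%:Z%:E; exists i0.
have [[N NP]|nb] :=
  pselect (exists N : nat, forall i, (N < i)%N -> is_zero (G i)).
  have ub i : `[< ~ is_zero (G i) >] -> (i <= N)%N.
    by move=> /asboolP Gi; rewrite leqNgt; apply/negP => /NP.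
  have ex : exists i, `[< ~ is_zero (G i) >] by exists i0; apply/asboolP.
  case: (ex_maxnP ex ub) => n /asboolP Gn nmax.
  apply: Or32; exists n; split=> //; last first.
    move=> i ni; apply: contrapT => /asboolP/nmax.
    by rewrite leqNgt ni.
  apply: supE => //; split=> [_ [i Gi ->]|y yub]; last by apply: yub; exists n.
  by rewrite lee_fin lez_nat; apply/nmax/asboolP.
have unb (n : nat) : exists2 i, (n < i)%N & ~ is_zero (G i).
  apply: contrapT => nex; apply: nb; exists n => i ni.
  by apply: contrapT => Gi; apply: nex; exists i.
apply: Or33; split=> //; apply: supE => //; split=> [l _|y yub].
  exact: leey.
case: y yub => [r|//|] yub.
- have [i ri Gi] := unb `|r|%N.
  have : (i%:Z%:E <= r%:E :> \bar int)%E by apply: yub; exists i.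
  rewrite lee_fin => /le_trans/(_ (lez_abs r)).
  by rewrite lez_nat leqNgt ri.
- have : (i0%:Z%:E <= -oo :> \bar int)%E by apply: yub; exists i0.
  by [].
Qed.

(** Lengths are natural numbers or infinite, hence well ordered. *)
Lemma resolution_dim_attained (cls : lmodType R -> Prop) M :
    (exists G, is_resolution cls M G) ->
  exists2 G, is_resolution cls M G &
    resolution_dim cls M = complex_length G /\
    forall G', is_resolution cls M G' ->
      (complex_length G <= complex_length G')%E.
Proof.
move=> [G0 G0r].
suff [G Gr Gmin] : exists2 G, is_resolution cls M G &
    forall G', is_resolution cls M G' ->
      (complex_length G <= complex_length G')%E.
  exists G => //; split=> //; apply: infimum_min; first by exists G.
  by move=> _ [G' G'r ->]; apply: Gmin.
have [[G Gr Ginf]|no] :=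
  pselect (exists2 G, is_resolution cls M G & complex_length G = -oo%E).
  by exists G => // G' _; rewrite Ginf leNye.
pose p (n : nat) :=
  `[< exists2 G, is_resolution cls M G & complex_length G = n%:Z%:E >].
have [ex|nfin] := pselect (exists n, p n); last first.
  exists G0 => // G' G'r.
  have [[G'inf _]|[n [G'n _ _]]|[-> _]] := complex_lengthP G'.
  - by case: no; exists G'.
  - by case: nfin; exists n; apply/asboolP; exists G'.
  - exact: leey.
case: (ex_minnP ex) => n /asboolP[G Gr Gn] nmin.
exists G => // G' G'r.
have [[G'inf _]|[m [G'm _ _]]|[-> _]] := complex_lengthP G'.
- by case: no; exists G'.
- by rewrite Gn G'm lee_fin lez_nat; apply: nmin; apply/asboolP; exists G'.
- exact: leey.
Qed.

Lemma resolution_dim_none (cls : lmodType R -> Prop) M :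
  ~ (exists G, is_resolution cls M G) -> resolution_dim cls M = +oo%E.
Proof.
move=> nex; rewrite /resolution_dim; set D := [set l | _].
have -> : D = set0.
  by apply/seteqP; split=> // l [G Gr _]; apply: nex; exists G.
by rewrite /infimum eqxx.
Qed.

Definition iso_closed (cls : lmodType R -> Prop) : Prop :=
  forall A B (f : {linear A -> B}), bijective f -> cls A -> cls B.

Section Class.
Variable cls : lmodType R -> Prop.
Hypothesis cls_iso : iso_closed cls.
Hypothesis cls_zero : forall Z, is_zero Z -> cls Z.

Lemma dim_le_of_resolution n M (G : nat_complex R) :
    is_resolution cls M G -> (forall i, (n < i)%N -> is_zero (G i)) ->
  dim_le cls n M.
Proof.
elim: n M G => [|n IHn] M G [Gcls [aug [augs e0 e]]] Gz.
  apply: (cls_iso (f := aug)) (Gcls 0%N); apply: linear_bijective => //.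
  apply: linear_inj => x /e0[y <-].
  by rewrite (Gz 1%N _ y) // linear0.
have [K [i ia]] := ex_ses_ker augs; have [ii _ ei] := ia.
have [x|p pE] := ses_factor_mono (h := ndiff G 0) ia.
  exact: (ses_comp0 _ e0).
exists K, (G 0%N); split=> //; last by exists i, aug.
pose G' := @NatComplex R (fun n => G n.+1) (fun n => ndiff G n.+1).
apply: (IHn K G'); last by move=> k nk; apply: (Gz k.+1).
split=> [k|]; first exact: (Gcls k.+1).
exists p; split=> [z|y|k]; last exact: (e k.+1).
- have /e0[x xz] : aug (i z) = 0 by apply: (ses_comp0 _ ei).
  by exists x; apply: ii; rewrite pE.
- rewrite -(e 0%N y) -pE; split=> [->|]; first exact: linear0.
  exact: (linear_inj0 ii).
Qed.

Lemma resolution_of_dim_le n M : dim_le cls n M ->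
  exists2 G, is_resolution cls M G & forall i, (n < i)%N -> is_zero (G i).
Proof.
have Z0 := @zero_modP R.
elim: n M => [|n IHn] M.
  move=> cM; exists (@NatComplex R (fun i => if i is 0 then M else zero_mod R)
    (fun i => \0)); last by case.
  split=> [[|i]//|]; first exact: cls_zero.
  exists idfun; split=> [x|x|i x]; first by exists x.
    by split=> [x0|[y <-]//]; exists 0; apply: esym x0.
  by split=> [_|_]; [exists 0; apply/esym/Z0|].
move=> [K [P [cP /IHn[G [Gcls [aug [augs e0 e]]] Gz] [i [p [ii ps ip]]]]]].
pose obj n := if n is n'.+1 then G n' else P.
pose dif n : {linear obj n.+1 -> obj n} :=
  match n return {linear obj n.+1 -> obj n} with
  | 0 => i \o aug
  | n'.+1 => ndiff G n'
  end.
exists (@NatComplex R obj dif); last by case=> // k nk; apply: (Gz k).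
split=> [[|k]//|]; first exact: Gcls.
exists p; split=> // [y|[|k] //= y].
- rewrite ip; split=> [[z <-]|[x <-]]; last by exists (aug x).
  by have [x <-] := augs z; exists x.
- rewrite -(e0 y) /=; split=> [/(linear_inj0 ii)//|->]; exact: linear0.
Qed.

Lemma resolution_dim_le n M :
  (resolution_dim cls M <= n%:Z%:E)%E <-> dim_le cls n M.
Proof.
split=> [le_n|dM].
  have [ex|nex] := pselect (exists G, is_resolution cls M G); last first.
    by rewrite resolution_dim_none in le_n.
  have [G Gr [GE _]] := resolution_dim_attained ex.
  apply: (dim_le_of_resolution Gr) => i ni; rewrite GE in le_n.
  have [[_ Gz]|[m [Gm _ Gz]]|[Ginf _]] := complex_lengthP G.
  - exact: Gz.
  - apply: Gz; apply: leq_ltn_trans ni.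
    by rewrite Gm lee_fin lez_nat in le_n.
  - by rewrite Ginf in le_n.
have [G Gr Gz] := resolution_of_dim_le dM.
have [|G' G'r [-> G'min]] := @resolution_dim_attained cls M; first by exists G.
apply: le_trans (G'min G Gr) _.
have [[-> _]|[m [-> Gm _]]|[_ unb]] := complex_lengthP G.
- exact: leNye.
- by rewrite lee_fin lez_nat leqNgt; apply/negP => /Gz.
- by have [i /Gz] := unb n.
Qed.

Lemma resolution_dim_zero M : is_zero M -> resolution_dim cls M = -oo%E.
Proof.
move=> M0.
pose G := @NatComplex R (fun _ => M) (fun _ => \0).
have Gr : is_resolution cls M G.
  split=> [i|]; first exact: cls_zero.
  exists idfun; split=> [x|x|i x]; first by exists x.
    by split=> _; [exists 0; rewrite (M0 x)|apply: M0].
  by split=> _; [exists 0; rewrite (M0 x)|apply: M0].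
have [|G' G'r [-> G'min]] := @resolution_dim_attained cls M; first by exists G.
apply/eqP; rewrite -leeNy_eq; apply: le_trans (G'min G Gr) _.
have [[-> _]//|[m [_ Gm _]]|[_ /(_ 0%N)[i _ Gi]]] := complex_lengthP G.
  by case: Gm.
by case: Gi.
Qed.

Lemma resolution_dim_fin M : ~ is_zero M -> (resolution_dim cls M < +oo)%E ->
  exists n : nat, resolution_dim cls M = n%:Z%:E.
Proof.
move=> M0 lt_oo.
have [ex|nex] := pselect (exists G, is_resolution cls M G); last first.
  by rewrite resolution_dim_none ?ltxx in lt_oo.
have [G Gr [GE _]] := resolution_dim_attained ex.
have [[_ Gz]|[m [Gm _ Gz]]|[Ginf _]] := complex_lengthP G.
- case: M0 => x; have [_ [aug [augs _ _]]] := Gr.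
  by have [y <-] := augs x; rewrite (Gz 0%N y) linear0.
- by exists m; rewrite GE.
- by rewrite GE Ginf ltxx in lt_oo.
Qed.

End Class.

Lemma bijective_short_exact A B (f : {linear A -> B}) :
  bijective f -> short_exact A B (zero_mod R).
Proof.
move=> [g fK gK]; exists f, \0; split=> [|z|y]; first exact: can_inj fK.
  by exists 0; rewrite (zero_modP z).
by split=> // _; exists (g y).
Qed.

Lemma flat_iso : iso_closed (@flat R).
Proof.
move=> A B f /bijective_short_exact s Af.
by apply: flat_ext s Af _; apply/flat_zero/zero_modP.
Qed.

Lemma GF_iso : iso_closed (@GF R).
Proof.
move=> A B f /bijective_short_exact s Af.
by apply: GF_ext_flat s Af _; apply/flat_zero/zero_modP.
Qed.

Lemma gorenstein_flatE : @gorenstein_flat R = @GF R.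
Proof.
apply/funext => X; apply/propext.
by split; [apply: gorenstein_flat_GF|apply: GF_gorenstein_flat].
Qed.

End Dimension.

Theorem theorem3p1 (R : comNzRingType) (M : lmodType R)
    (hR : noetherian R) (hM : (Gfd M < +oo)%E) :
  exists (K : lmodType R) (phi : {linear M -> K}),
    [/\ injective phi, CF_preenvelope phi,
        fd K = Gfd M & gorenstein_flat (coker phi)].
Proof.
rewrite /Gfd gorenstein_flatE in hM *.
have GF0 (Z : lmodType R) (Z0 : is_zero Z) := GF_flat (flat_zero Z0).
have dimG := resolution_dim_le (@GF_iso R) GF0.
have dimF := resolution_dim_le (@flat_iso R) (@flat_zero R).
(* the zero module has dimension -oo, so it must be its own envelope *)
have [M0|M0] := pselect (is_zero M).
  exists M, idfun; split=> //; last 2 first.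
  - by rewrite /fd !resolution_dim_zero //; apply: flat_zero.
  - apply: GF0 => z; have [x <-] := quot_proj_surj z.
    by apply/coker_exact; exists x.
  split; last by move=> Y _ f; exists f.
  split; last by rewrite /fd resolution_dim_zero //; apply: flat_zero.
  apply/cotorsion_Ext1 => F _ X Y i p _ f; exists \0 => x.
  by rewrite (M0 (f x)).
have [n nE] := resolution_dim_fin M0 hM.
have /GF_embedding-/(_ hR)[K0 [C0 [dK0 GC0 s0]]] : dim_le (@GF R) n M.
  by apply/dimG; rewrite nE.
have [K [F [Kc dK Ff s1]]] := ex_cotorsion_embedding hR dK0.
have [C [phi [q phiq]] s2] := compose_mono s0 s1.
have GC := GF_ext_flat s2 GC0 Ff.
have [phii qs e] := phiq.
have fdK : (fd K <= n%:Z%:E)%E by apply/dimF.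
have K0' : ~ is_zero K.
  by move=> K0'; apply: M0 => x; apply: (linear_inj0 phii).
exists K, phi; split=> //.
- split; first by split=> //; apply: le_lt_trans fdK _; apply: ltey.
  move=> Y [Yc fdY] f.
  have [Y0|Y0] := pselect (is_zero Y).
    by exists \0 => x; rewrite (Y0 (f x)).
  have [m mE] := resolution_dim_fin Y0 fdY.
  have dY : dim_le (@flat R) m Y by apply/dimF; rewrite mE.
  exact: (Ext1_GF_CF hR GC dY Yc phiq).
- rewrite nE; apply/eqP; rewrite eq_le fdK /=.
  have [|m mE] := resolution_dim_fin (cls := @flat R) K0'.
    by apply: le_lt_trans fdK _; apply: ltey.
  rewrite /fd mE -nE; apply/dimG.
  apply: (GF_dim_le_of_embedding (K := K) (C := C)) => //.
    by apply/dimF; rewrite mE.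
  by exists phi, q.
- have [|h hE] := ses_factor_epi
    (h := quot_proj (im phi) : {linear K -> coker phi}) phiq.
    by move=> a; apply/coker_exact; exists a.
  apply: (GF_iso (f := h)) GC; apply: linear_bijective => [|z].
    apply: linear_inj => c; have [b <-] := qs c.
    by rewrite hE => /coker_exact/e.
  by have [b <-] := quot_proj_surj z; exists (q b); rewrite hE.
Qed.
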